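(* Let $F$ be a graph with $e(F)>0$, let $m=|F|$, let $0<p\le 1$, and let $(\alpha_1,\dots,\alpha_m)$ be a vector of positive numbers with $\sum_{i=1}^m\alpha_i\le 1$. (i) If $(\alpha_1,\dots,\alpha_m)\neq(1/m,\dots,1/m)$, then $\widetilde{\mathcal P}(F;\alpha_1,\dots,\alpha_m)$ and the stronger $\mathcal P^{u}(F;\alpha_1,\dots,\alpha_m)$ are $p$-quasi-random properties. (ii) If $\sum_{i=1}^m\alpha_i<1$, then for every labelling of $F$, $\mathcal P(F;\alpha_1,\dots,\alpha_m)$ is a $p$-quasi-random property.
   Context: Graphs are finite, simple, undirected; $|G|$ is the number of vertices, $e(G)$ the number of edges. A labelled graph $F$ has $V(F)=\{1,\dots,m\}$. For a labelled graph $F$, a graph $G$ and subsets $U_1,\dots,U_m\subseteq V(G)$, $N(F,G;U_1,\dots,U_m)$ is the number of injective maps $\varphi:V(F)\to V(G)$ that are graph homomorphisms with $\varphi(i)\in U_i$ for all $i$; $\widetilde N(F,G;U_1,\dots,U_m):=\frac1{m!}\sum_{\sigma}N(F,G;U_{\sigma(1)},\dots,U_{\sigma(m)})$ (sum over all permutations $\sigma$ of $\{1,\dots,m\}$). Also $N(F,G)$ is the number of injective homomorphisms $V(F)\to V(G)$. A sequence $(G_n)$ with $|G_n|\to\infty$ is $p$-quasi-random if $N(F,G_n)=(p^{e(F)}+o(1))|G_n|^{|F|}$ for every graph $F$. A property of such sequences is a $p$-quasi-random property if a sequence $(G_n)$ (with $|G_n|\to\infty$) satisfies it if and only if it is $p$-quasi-random.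 Properties (all $o(\cdot)$ terms are as $n\to\infty$ and uniform over the choice of subsets): for labelled $F$, $\mathcal P(F;\alpha_1,\dots,\alpha_m)$ means that for all pairwise disjoint $U_1,\dots,U_m\subseteq V(G_n)$ with $|U_i|=\lfloor\alpha_i|G_n|\rfloor$, $N(F,G_n;U_1,\dots,U_m)=p^{e(F)}\prod_{i=1}^m|U_i|+o(|G_n|^m)$; $\mathcal P^u(F;\alpha_1,\dots,\alpha_m)$ means $\mathcal P(F;\alpha_1,\dots,\alpha_m)$ holds for every labelling of $F$; $\widetilde{\mathcal P}(F;\alpha_1,\dots,\alpha_m)$ means the same as $\mathcal P$ but with $\widetilde N$ in place of $N$. *)

(* Defs.v *)
From mathcomp Require Import all_boot all_order all_algebra all_fingroup.
From mathcomp Require Import boolp classical_sets reals topology.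
Set Implicit Arguments.
Unset Strict Implicit.
Unset Printing Implicit Defensive.
Import Order.TTheory GRing.Theory Num.Theory.
Local Open Scope classical_set_scope.
Local Open Scope ring_scope.

Record sgraph (V : finType) := SGraph {
  adj :> rel V;
  adj_sym : symmetric adj;
  adj_irr : irreflexive adj }.

Definition edges (V : finType) (G : sgraph V) : {set {set V}} :=
  [set e : {set V} | [exists x, exists y, G x y && (e == [set x; y]%SET)]]%SET.

Definition num_edges (V : finType) (G : sgraph V) : nat := #|edges G|.

Record graph := Graph { vertex : finType; structure :> sgraph vertex }.

Definition num_vertices (G : graph) : nat := #|vertex G|.

(* A labelled graph on m vertices is an sgraph on 'I_m (labels 0, ..., m-1);   *)
(* a labelling of a graph on W is a bijection l : 'I_#|W| -> W.               *)
Section Relabel.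
Variables (W : finType) (F : sgraph W) (m : nat) (l : 'I_m -> W).

Let radj : rel 'I_m := fun i j => F (l i) (l j).

Fact radj_sym : symmetric radj.
Proof. by move=> i j; exact: adj_sym. Qed.

Fact radj_irr : irreflexive radj.
Proof. by move=> i; exact: adj_irr. Qed.

Definition relabel : sgraph 'I_m := SGraph radj_sym radj_irr.

End Relabel.

Definition inj_homs (W : finType) (F : sgraph W) (V : finType) (G : sgraph V) :
    {set {ffun W -> V}} :=
  [set f : {ffun W -> V} | injectiveb f &&
     [forall x, forall y, F x y ==> G (f x) (f y)]]%SET.

Definition N (W : finType) (F : sgraph W) (V : finType) (G : sgraph V) : nat :=
  #|inj_homs F G|.

Definition NU (m : nat) (F : sgraph 'I_m) (V : finType) (G : sgraph V)
    (U : 'I_m -> {set V}) : nat :=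
  #|[set f in inj_homs F G | [forall i, f i \in U i]]%SET|.

Definition NUtilde (R : realType) (m : nat) (F : sgraph 'I_m) (V : finType)
    (G : sgraph V) (U : 'I_m -> {set V}) : R :=
  (m`!)%:R^-1 * \sum_(s : 'S_m) (NU F G (fun i => U (s i)))%:R.

Definition order_to_infinity (G : nat -> graph) : Prop :=
  (fun n => num_vertices (G n)) @ \oo --> \oo.

Definition quasi_random (R : realType) (p : R) (G : nat -> graph) : Prop :=
  forall (W : finType) (F : sgraph W) (eps : R), 0 < eps ->
  \forall n \near \oo,
    `|(N F (G n))%:R - p ^+ num_edges F * (num_vertices (G n))%:R ^+ #|W| |
      <= eps * (num_vertices (G n))%:R ^+ #|W|.

Definition quasi_random_property (R : realType) (p : R)
    (P : (nat -> graph) -> Prop) : Prop :=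
  forall G : nat -> graph, order_to_infinity G -> (P G <-> quasi_random p G).

Definition admissible (R : realType) (m : nat) (alpha : 'I_m -> R)
    (V : finType) (U : 'I_m -> {set V}) : Prop :=
  (forall i j, i != j -> [disjoint U i & U j]%B) /\
  (forall i, #|U i|%:Z = Num.floor (alpha i * #|V|%:R)).

(* The error o(|G_n|^m) is uniform in U: the threshold on n depends on eps    *)
(* only.                                                                      *)
Definition P (R : realType) (p : R) (m : nat) (F : sgraph 'I_m)
    (alpha : 'I_m -> R) (G : nat -> graph) : Prop :=
  forall eps : R, 0 < eps -> \forall n \near \oo,
  forall U : 'I_m -> {set vertex (G n)}, admissible alpha U ->
    `|(NU F (G n) U)%:R - p ^+ num_edges F * \prod_(i < m) #|U i|%:R|
      <= eps * (num_vertices (G n))%:R ^+ m.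

Definition Ptilde (R : realType) (p : R) (m : nat) (F : sgraph 'I_m)
    (alpha : 'I_m -> R) (G : nat -> graph) : Prop :=
  forall eps : R, 0 < eps -> \forall n \near \oo,
  forall U : 'I_m -> {set vertex (G n)}, admissible alpha U ->
    `|NUtilde R F (G n) U - p ^+ num_edges F * \prod_(i < m) #|U i|%:R|
      <= eps * (num_vertices (G n))%:R ^+ m.

Definition Pu (R : realType) (p : R) (W : finType) (F : sgraph W)
    (alpha : 'I_#|W| -> R) (G : nat -> graph) : Prop :=
  forall l : 'I_#|W| -> W, bijective l -> P p (relabel F l) alpha G.

(* Main.v *)
(** Everything is compared with the statement "the cut norm of G - p is small",
    which the counts of the subgraphs of C_4 detect and which the counting lemma
    turns back into any count of copies of F, with or without prescribed sets.

    For the converse, random rounding replaces the disjoint sets of sizes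
    [floor (alpha_i n)] by weights [u_i : V -> [0, 1]] with [sum_i u_i <= 1] and mean
    [alpha_i].  The count is multilinear in [u].  If [sum_i alpha_i < 1] every [u_i]
    can be perturbed separately, so the constraint on [u_i] can be dropped for one
    coordinate after the other.  If the count is symmetric and [alpha_a <> alpha_b],
    moving mass [s] between [u_a] and [u_b] changes it by
    [(alpha_b - alpha_a) g(1, s) - g(s, s)] with [g] bilinear symmetric; the odd and
    even parts in [s] vanish separately, which frees the coordinates [a] and [b].

    Thus the symmetrised density of F in G equals [p ^ e(F)] against all product
    weights.  A strong regularity lemma turns this into an L^1 statement about a
    matrix [w] which is close to G in cut norm.  Finally, if the symmetrised density
    of an infinite matrix [w] is [p ^ e(F)] on all tuples, iterated ultralimits give
    tuples on which all entries but one are known; they show successively that the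
    limit entry [c], the limits [a_i] of the rows, and [w_01] are equal to [p]. *)
Require Import Defs.
From mathcomp Require Import all_boot all_order all_algebra all_fingroup.
From mathcomp Require Import boolp classical_sets reals topology normedtype.
From mathcomp Require Import ring lra zify.
Set Implicit Arguments.
Unset Strict Implicit.
Unset Printing Implicit Defensive.
Import Order.TTheory GRing.Theory Num.Theory.
Import numFieldNormedType.Exports.
Local Open Scope ring_scope.

(** * Sums over tuples and the counting lemma *)

(** The obstacle in the last step is cancellation: on a general tuple some entries of [w] exceed [p]
    and others fall short, so one value of the average says nothing. Tuples whose entries take a
    single unknown value besides [p] put every term of the average on the same side, and
    monotonicity applies. Such tuples exist only in the limit of an infinite matrix, hence a
    compactness argument on samples of bounded size. Strong rather than weak regularity is forced by
    the passage to L^1: absolute values are removed separately on each of the |C|^m boxes of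
    classes, so G must be approximated with an error small compared with |C|^-m. A single partition
    does not give this. A fine one, chosen after |C| is known, approximates G in cut norm, and a
    coarse one with |C| classes approximates the fine one in L^2, a cost paid once for all boxes
    together. At the exceptional vector both freedoms disappear: the sum has no slack, and the
    factor alpha_b - alpha_a of the linear term g(1, s) is zero for every pair. *)

Section FfunSums.
Variables (R : realType) (V : finType).

Definition upd (I : finType) (x : {ffun I -> V}) (i : I) (y : V) : {ffun I -> V} :=
  [ffun j => if j == i then y else x j].

(** The map [(x, y) |-> (upd x i y, x i)] is an involution that exchanges [y] with the value at [i].
    Applied to several coordinates it isolates them, at the cost of one factor [#|V|] each and
    without any division. *)
Lemma sum_update (I : finType) (i : I) (phi : {ffun I -> V} -> R) :
  \sum_x \sum_y phi (upd x i y) = #|V|%:R * \sum_x phi x.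
Proof.
rewrite pair_big /=.
rewrite (reindex_inj (h := fun q : {ffun I -> V} * V => (upd q.1 i q.2, q.1 i))) /=; last first.
  apply: (can_inj (g := fun q => (upd q.1 i q.2, q.1 i))) => -[x y] /=.
  by congr (_, _); [apply/ffunP=> j|]; rewrite !ffunE ?eqxx //; case: eqP => [->|].
rewrite (eq_bigr (fun q => phi q.1)) => [|[x y] _ /=]; last first.
  by congr phi; apply/ffunP => j; rewrite !ffunE; case: eqP => [->|].
rewrite -(pair_big xpredT xpredT (fun x (_ : V) => phi x)) /= mulr_sumr.
by apply: eq_bigr => x _; rewrite sumr_const mulr_natl.
Qed.

Lemma sum_ffun1 (K : finType) : \sum_(x : {ffun K -> V}) (1 : R) = #|V|%:R ^+ #|K|.
Proof. by rewrite sumr_const card_ffun natrX. Qed.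

(* Exchanging [x] with the values of [z] along [t] is an involution of the pairs
   [(z, x)]. *)
Lemma sum_marginal (I J : finType) (t : J -> I) (phi : {ffun J -> V} -> R) :
  injective t ->
  #|V|%:R ^+ #|J| * \sum_(z : {ffun I -> V}) phi [ffun j => z (t j)] =
  #|V|%:R ^+ #|I| * \sum_x phi x.
Proof.
move=> tI.
pose ov (z : {ffun I -> V}) (x : {ffun J -> V}) : {ffun I -> V} :=
  [ffun i => if [pick j | t j == i] is Some j then x j else z i].
have ovt z x j : ov z x (t j) = x j.
  rewrite ffunE; case: pickP => [j' /eqP/tI -> //|/(_ j)]; by rewrite eqxx.
pose sw (q : {ffun I -> V} * {ffun J -> V}) :=
  (ov q.1 q.2, [ffun j => q.1 (t j)] : {ffun J -> V}).
have swK : cancel sw sw.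
  move=> [z x]; congr (_, _) => /=; apply/ffunP => i; last by rewrite ffunE ovt.
  rewrite ffunE; case: pickP => [j /eqP <-|nj]; first by rewrite ffunE.
  by rewrite ffunE; case: pickP => // j; rewrite nj.
rewrite -!sum_ffun1 !mulr_suml.
under eq_bigr => x _ do rewrite mul1r.
under [RHS]eq_bigr => x _ do rewrite mul1r.
rewrite exchange_big !pair_big /= [RHS](reindex_inj (can_inj swK)).
by [].
Qed.

Lemma sum_eq_coord (I : finType) (i j : I) : i != j ->
  #|V|%:R * \sum_(x : {ffun I -> V}) ((x i == x j)%:R : R) = #|V|%:R ^+ #|I|.
Proof.
move=> ij; have ji : (j == i) = false by rewrite eq_sym (negPf ij).
rewrite -(sum_update i) -sum_ffun1; apply: eq_bigr => x _.
rewrite (bigD1 (x j)) //= !ffunE eqxx ji eqxx big1 ?addr0 // => y yx.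
by rewrite !ffunE eqxx ji (negPf yx).
Qed.

(** Union bound over the pairs of distinct coordinates: each pair agrees on a fraction 1/n of the
    tuples. This pays for replacing injective maps by all maps. *)
Lemma sum_noninj (I : finType) : (0 < #|V|)%N ->
  \sum_(x : {ffun I -> V}) ((~~ injectiveb x)%:R : R)
    <= #|I|%:R ^+ 2 / #|V|%:R * #|V|%:R ^+ #|I|.
Proof.
move=> V0; rewrite [leRHS]mulrAC ler_pdivlMr ?ltr0n // [leLHS]mulrC.
pose P (ij : I * I) := ij.1 != ij.2.
have le1 (x : {ffun I -> V}) :
    ((~~ injectiveb x)%:R : R) <= \sum_(ij | P ij) (x ij.1 == x ij.2)%:R.
  case: (boolP (injectiveb x)) => [_|/injectivePn[i [j ij e]]].
    by apply: sumr_ge0 => *; exact: ler0n.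
  rewrite (bigD1 (i, j)) //= e eqxx lerDl.
  by apply: sumr_ge0 => *; exact: ler0n.
apply: (@le_trans _ _ (\sum_(ij | P ij) (#|V|%:R : R) ^+ #|I|)).
  rewrite (eq_bigr (fun ij => #|V|%:R * \sum_(x : {ffun I -> V}) (x ij.1 == x ij.2)%:R)); last first.
    by move=> ij /sum_eq_coord ->.
  rewrite -mulr_sumr ler_wpM2l ?ler0n // exchange_big /=.
  by apply: ler_sum => x _; exact: le1.
rewrite sumr_const -[leLHS]mulr_natl ler_wpM2r ?exprn_ge0 ?ler0n //.
rewrite -natrX ler_nat (leq_trans (max_card _)) // card_prod expnS expn1.
by [].
Qed.

End FfunSums.

Section Counting.
Variables (R : realType).

Definition unit_itv (x : R) := (0 <= x) && (x <= 1).

Lemma unit_itv_prod (I : finType) (Q : pred I) (F : I -> R) :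
  (forall i, Q i -> unit_itv (F i)) -> unit_itv (\prod_(i | Q i) F i).
Proof.
move=> H; apply/andP; split.
  by apply: prodr_ge0 => i /H /andP[].
by apply: prodr_ile1 => i /H.
Qed.

Lemma unit_itvM (x y : R) : unit_itv x -> unit_itv y -> unit_itv (x * y).
Proof. by move=> /andP[? ?] /andP[? ?]; rewrite /unit_itv mulr_ge0 //= mulr_ile1. Qed.

Lemma sum_weight_le (V : finType) (c u : V -> R) : (forall x, unit_itv (u x)) ->
  \sum_x u x * c x <= \sum_(x | 0 < c x) c x.
Proof.
move=> uU; rewrite (bigID (fun x => 0 < c x)) /= -[leRHS]addr0; apply: lerD.
  apply: ler_sum => x c0; have /andP[_ u1] := uU x.
  by rewrite -[leRHS]mul1r ler_wpM2r // ltW.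
apply: sumr_le0 => x; rewrite -leNgt => c0; have /andP[u0 _] := uU x.
by rewrite mulr_ge0_le0.
Qed.

Variable V : finType.

Definition cut_le (h : V -> V -> R) (D : R) :=
  forall S T : {set V}, `|\sum_(x in S) \sum_(y in T) h x y| <= D.

(** A form linear in each of two weights is largest at indicators: [u] becomes the indicator of the
    vertices with a positive coefficient, then [v] is treated alike for the set so found. *)
Lemma cut_le_weight1 (h : V -> V -> R) (D : R) (u v : V -> R) :
  (forall S T : {set V}, \sum_(x in S) \sum_(y in T) h x y <= D) ->
  (forall x, unit_itv (u x)) -> (forall x, unit_itv (v x)) ->
  \sum_x \sum_y h x y * u x * v y <= D.
Proof.
move=> hD uU vU.
have -> : \sum_x \sum_y h x y * u x * v y = \sum_x u x * (\sum_y v y * h x y).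
  by apply: eq_bigr => x _; rewrite mulr_sumr; apply: eq_bigr => y _; ring.
apply: le_trans (sum_weight_le _ uU) _.
pose Q x := 0 < \sum_y v y * h x y.
rewrite -[X in X <= _]/(\sum_(x | Q x) \sum_y v y * h x y).
rewrite exchange_big /=.
under eq_bigr => y _ do rewrite -mulr_sumr.
apply: le_trans (sum_weight_le _ vU) _.
rewrite exchange_big /= -[leLHS](_ : \sum_(x in [set x | Q x])
   \sum_(y in [set y | 0 < \sum_(i | Q i) h i y]) h x y = _); first exact: hD.
apply: eq_big => [x|x _]; first by rewrite inE.
by apply: eq_bigl => y; rewrite inE.
Qed.

Lemma cut_le_weight (h : V -> V -> R) (D : R) (u v : V -> R) :
  cut_le h D -> (forall x, unit_itv (u x)) -> (forall x, unit_itv (v x)) ->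
  `|\sum_x \sum_y h x y * u x * v y| <= D.
Proof.
move=> hD uU vU; rewrite ler_norml; apply/andP; split; last first.
  by apply: cut_le_weight1 => // S T; apply: le_trans (ler_norm _) (hD S T).
rewrite lerNl -sumrN.
under eq_bigr => x _ do rewrite -sumrN.
have -> : \sum_x \sum_y - (h x y * u x * v y) = \sum_x \sum_y (- h x y) * u x * v y.
  by apply: eq_bigr => x _; apply: eq_bigr => y _; ring.
apply: cut_le_weight1 => // S T; apply: le_trans (hD S T).
rewrite -[X in _ <= `|X|]opprK normrN -sumrN.
by under [X in _ <= `|X|]eq_bigr => x _ do rewrite -sumrN; exact: ler_norm.
Qed.

Variables (I : finType) (F : sgraph I).

(* Each edge is listed once, oriented by the enumeration of [I]. *)
Definition epair (e : I * I) : bool := F e.1 e.2 && (enum_rank e.1 < enum_rank e.2)%N.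

Lemma card_epair : #|[pred e | epair e]| = num_edges F.
Proof.
rewrite -cardsE /num_edges.
rewrite -(@card_in_imset _ _ (fun e : I * I => [set e.1; e.2]%SET)).
  congr #|pred_of_set _|; apply/setP => s; rewrite inE.
  apply/imsetP/existsP => [[[i j]]|[i /existsP[j /andP[ij /eqP ->]]]].
    rewrite inE /epair /= => /andP[ij _] ->; exists i; apply/existsP; exists j.
    by rewrite ij eqxx.
  have [lt|lt|/val_inj/enum_rank_inj e] := ltngtP (enum_rank i) (enum_rank j).
  - by exists (i, j); rewrite // !inE /epair /= ij.
  - by exists (j, i); [rewrite !inE /epair /= adj_sym ij | rewrite finset.setUC].
  - by rewrite e adj_irr in ij.
move=> [i j] [k l]; rewrite !inE /epair /= => /andP[_ ij] /andP[_ kl] E.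
have : i \in [set k; l]%SET by rewrite -E !inE eqxx.
have : j \in [set k; l]%SET by rewrite -E !inE eqxx orbT.
rewrite !inE => /orP[]/eqP jE /orP[]/eqP iE; subst => //.
- by rewrite ltnn in ij.
- by have := ltn_trans ij kl; rewrite ltnn.
- by rewrite ltnn in ij.
Qed.

(* Once the other vertices are fixed, no factor but [h] involves both [x i] and
   [x j]. *)
Lemma single_edge (i j : I) (v : I * I -> V -> V -> R) (a : I -> V -> R)
    (h : V -> V -> R) (D : R) :
  epair (i, j) -> (forall e x y, unit_itv (v e x y)) -> (forall k x, unit_itv (a k x)) ->
  cut_le h D ->
  #|V|%:R ^+ 2 * `|\sum_(x : {ffun I -> V}) h (x i) (x j) *
     (\prod_(e | epair e && (e != (i, j))) v e (x e.1) (x e.2)) * \prod_k a k (x k)|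
  <= D * #|V|%:R ^+ #|I|.
Proof.
move=> ijE vU aU hD.
pose Phi (x : {ffun I -> V}) := h (x i) (x j) *
  (\prod_(e | epair e && (e != (i, j))) v e (x e.1) (x e.2)) * \prod_k a k (x k).
rewrite -[\sum_x _]/(\sum_x Phi x).
have -> : #|V|%:R ^+ 2 * `|\sum_x Phi x| =
    `|\sum_x \sum_y \sum_z Phi (upd (upd x i y) j z)|.
  rewrite (sum_update i (fun x => \sum_z Phi (upd x j z))) (sum_update j).
  by rewrite !normrM normr_nat expr2 mulrA.
rewrite -sum_ffun1 mulr_sumr; apply: le_trans (ler_norm_sum _ _ _) _.
apply: ler_sum => x _; rewrite mulr1.
have ij : i != j.
  by apply/eqP => ij; move: ijE; rewrite /epair ij adj_irr.
(* An edge at [i] other than [(i, j)] misses [j], since [(j, i)] is ruled out by the orientation in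
   [epair]. Hence the factors at [i] form a function [u] of [y] alone and all others a function [w]
   of [z] alone. *)
pose ti (e : I * I) := (e.1 == i) || (e.2 == i).
pose u y := (\prod_(e | epair e && (e != (i, j)) && ti e) v e (upd x i y e.1) (upd x i y e.2))
   * a i y.
pose w z := (\prod_(e | epair e && (e != (i, j)) && ~~ ti e) v e (upd x j z e.1) (upd x j z e.2))
   * \prod_(k | k != i) a k (upd x j z k).
rewrite [X in `|X|](_ : _ = \sum_y \sum_z h y z * u y * w z).
  apply: cut_le_weight => // y; apply: unit_itvM => //; try exact: unit_itv_prod.
apply: eq_bigr => y _; apply: eq_bigr => z _.
rewrite /Phi !ffunE !eqxx (negPf ij) ?eqxx -!mulrA; congr (_ * _).
rewrite (bigID ti) /= (bigD1 i) //= /u /w !ffunE eqxx (negPf ij) ?eqxx.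
rewrite -!mulrA; congr (_ * _).
  apply: eq_bigr => -[k l] /=; rewrite /ti /epair /= => /andP[/andP[/andP[kl r] ne] t].
  have kj : k != j.
    apply/eqP => e; subst k; case/orP: t => /eqP e; first by rewrite e eqxx in ij.
    by subst l; move: ijE; rewrite /epair /= => /andP[_ /ltn_trans/(_ r)]; rewrite ltnn.
  have lj : l != j.
    apply/eqP => e; subst l; case/orP: t => /eqP e; last by rewrite e eqxx in ij.
    by subst k; rewrite eqxx in ne.
  by rewrite !ffunE (negPf kj) (negPf lj).
rewrite mulrCA; congr (_ * _); congr (_ * _).
  apply: eq_bigr => -[k l] /=; rewrite /ti /= => /andP[_]; rewrite negb_or => /andP[ki li].
  by rewrite !ffunE (negPf ki) (negPf li).
by apply: eq_bigr => k ki; rewrite !ffunE (negPf ki).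
Qed.

End Counting.

Lemma card_permT (I : finType) : #|{perm I}| = factorial #|I|.
Proof.
have := card_perm [set: I]%SET; rewrite cardsT => <-; apply: eq_card => s.
by rewrite !inE; apply/esym/fintype.subsetP => x _; rewrite inE.
Qed.

Lemma perm_average_le (R : realType) (I : finType) (A : {perm I} -> R) (x y : R) :
  (forall s, `|A s - x| <= y) ->
  `|(factorial #|I|)%:R^-1 * \sum_s A s - x| <= y.
Proof.
move=> Axy; have f0 : 0 < ((factorial #|I|)%:R : R) by rewrite ltr0n fact_gt0.
have cst (z : R) : \sum_(s : {perm I}) z = (factorial #|I|)%:R * z.
  by rewrite sumr_const card_permT -[LHS]mulr_natl.
rewrite -[x](mulKf (lt0r_neq0 f0)) -cst -mulrBr -sumrB normrM gtr0_norm ?invr_gt0 //.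
rewrite mulrC ler_pdivrMr // [leRHS]mulrC -cst.
by apply: le_trans (ler_norm_sum _ _ _) _; apply: ler_sum => s _.
Qed.

Section Hom.
Variables (R : realType) (I : finType) (F : sgraph I).

Definition hprod (T : Type) (w : T -> T -> R) (x : I -> T) : R :=
  \prod_(e | epair F e) w (x e.1) (x e.2).

(* Summed against the indicators of the sets [U i], [hsym] of the adjacency matrix
   gives [NUtilde]. *)
Definition hsym (T : Type) (w : T -> T -> R) (x : I -> T) : R :=
  (factorial #|I|)%:R^-1 * \sum_(s : {perm I}) hprod w (fun i => x (s i)).

Variable V : finType.

(** Telescoping over the edges: [v s] uses [w1] on the edges in [s] and [w2] elsewhere, and by
    [single_edge] each edge added to [s] changes the normalised sum by at most [d]. *)
Lemma counting (w1 w2 : V -> V -> R) (a : I -> V -> R) (d : R) :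
  (0 < #|V|)%N ->
  (forall x y, unit_itv (w1 x y)) -> (forall x y, unit_itv (w2 x y)) ->
  (forall k x, unit_itv (a k x)) ->
  cut_le (fun x y => w1 x y - w2 x y) (d * #|V|%:R ^+ 2) ->
  `|\sum_(x : {ffun I -> V}) (hprod w1 x - hprod w2 x) * \prod_k a k (x k)|
    <= (num_edges F)%:R * d * #|V|%:R ^+ #|I|.
Proof.
move=> V0 w1U w2U aU cut.
have n0 : 0 < (#|V|%:R : R) by rewrite ltr0n.
pose v (s : seq (I * I)) (e : I * I) := if e \in s then w1 else w2.
pose H s (x : {ffun I -> V}) := \prod_(e | epair F e) v s e (x e.1) (x e.2).
have step s : uniq s -> all (epair F) s ->
  `|\sum_(x : {ffun I -> V}) (H s x - hprod w2 x) * \prod_k a k (x k)|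
    <= (size s)%:R * d * #|V|%:R ^+ #|I|.
  elim: s => [|e s IH] /=.
    move=> _ _; rewrite big1 ?normr0 ?mul0r // => x _.
    by rewrite [H _ _](_ : _ = hprod w2 x) ?subrr ?mul0r.
  move=> /andP[es us] /andP[ee als].
  have -> : \sum_(x : {ffun I -> V}) (H (e :: s) x - hprod w2 x) * \prod_k a k (x k) =
     \sum_(x : {ffun I -> V}) (w1 (x e.1) (x e.2) - w2 (x e.1) (x e.2)) *
       (\prod_(e' | epair F e' && (e' != e)) v s e' (x e'.1) (x e'.2)) * \prod_k a k (x k)
     + \sum_(x : {ffun I -> V}) (H s x - hprod w2 x) * \prod_k a k (x k).
    rewrite -big_split /=; apply: eq_bigr => x _; rewrite -mulrDl; congr (_ * _).
    rewrite addrA; congr (_ - _).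
    have -> : H s x = w2 (x e.1) (x e.2) *
        \prod_(e' | epair F e' && (e' != e)) v s e' (x e'.1) (x e'.2).
      by rewrite /H (bigD1 e) //= {1}/v (negPf es).
    have -> : H (e :: s) x = w1 (x e.1) (x e.2) *
        \prod_(e' | epair F e' && (e' != e)) v s e' (x e'.1) (x e'.2).
      rewrite /H (bigD1 e) //= {1}/v inE eqxx /=; congr (_ * _).
      by apply: eq_bigr => e' /andP[_ ne]; rewrite /v inE (negPf ne).
    by ring.
  apply: le_trans (ler_normD _ _) _.
  rewrite -add1n natrD mulrDl mulrDl mul1r; apply: lerD; last exact: IH.
  have vU e' x y : unit_itv (v s e' x y) by rewrite /v; case: ifP.
  have := @single_edge R V I F e.1 e.2 (v s) a _ _ _ vU aU cut.
  rewrite -surjective_pairing => /(_ ee) /= le.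
  rewrite -(ler_pM2l (exprn_gt0 2 n0)); apply: le_trans le _.
  by rewrite [leRHS](_ : _ = d * #|V|%:R ^+ 2 * #|V|%:R ^+ #|I|) //; ring.
have /step : uniq (enum [pred e | epair F e]) by exact: enum_uniq.
have al : all (epair F) (enum [pred e | epair F e]).
  by apply/allP => e; rewrite mem_enum inE.
move=> /(_ al); rewrite -cardE card_epair.
rewrite (eq_bigr (fun x : {ffun I -> V} => (hprod w1 x - hprod w2 x) * \prod_k a k (x k))) //.
move=> x _; congr ((_ - _) * _); apply: eq_bigr => e ee.
by rewrite /v mem_enum inE ee.
Qed.

Lemma hprod_unit (T : Type) (w : T -> T -> R) x : (forall x y, unit_itv (w x y)) ->
  unit_itv (hprod w x).
Proof. by move=> wU; apply: unit_itv_prod => e _. Qed.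

Lemma hsym_unit (T : Type) (w : T -> T -> R) x : (forall x y, unit_itv (w x y)) ->
  unit_itv (hsym w x).
Proof.
move=> wU; have f0 : 0 < ((factorial #|I|)%:R : R) by rewrite ltr0n fact_gt0.
have hU (s : {perm I}) := hprod_unit (fun i => x (s i)) wU.
apply/andP; split.
  rewrite mulr_ge0 ?invr_ge0 ?(ltW f0) // sumr_ge0 // => s _.
  by have /andP[] := hU s.
rewrite /hsym mulrC ler_pdivrMr // mul1r.
apply: (@le_trans _ _ (\sum_(s : {perm I}) 1)).
  by apply: ler_sum => s _; have /andP[] := hU s.
by rewrite sumr_const card_permT.
Qed.

End Hom.

(** * Copies of a graph and discrepancy *)

Section GraphCounts.
Variable R : realType.

Definition gadj (V : finType) (G : sgraph V) (x y : V) : R := (G x y)%:R.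

Lemma gadj_unit (V : finType) (G : sgraph V) x y : unit_itv (gadj G x y).
Proof. by rewrite /unit_itv ler0n lern1; case: (G x y). Qed.

Lemma prod_bool (I : finType) (Q b : pred I) :
  \prod_(i | Q i) ((b i)%:R : R) = [forall i, Q i ==> b i]%:R.
Proof.
case: (boolP [forall i, Q i ==> b i]) => [/forallP H|/forallPn[i]].
  by rewrite big1 // => i Qi; have := H i; rewrite Qi /= => ->.
rewrite negb_imply => /andP[Qi /negPf bi].
by rewrite (bigD1 i) //= bi mul0r.
Qed.

Lemma hprod_gadj (I V : finType) (F : sgraph I) (G : sgraph V) (x : I -> V) :
  hprod F (gadj G) x = [forall i, forall j, F i j ==> G (x i) (x j)]%:R.
Proof.
rewrite /hprod /gadj prod_bool; congr (_%:R); congr nat_of_bool.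
apply/forallP/forallP => [H i|H [i j]].
  apply/forallP => j; apply/implyP => ij.
  have [lt|lt|/val_inj/enum_rank_inj e] := ltngtP (enum_rank i) (enum_rank j).
  - by have := H (i, j); rewrite /epair /= ij lt.
  - by have := H (j, i); rewrite /epair /= adj_sym ij lt adj_sym.
  - by rewrite e adj_irr in ij.
apply/implyP => /andP[ij _]; have /forallP/(_ j) := H i.
by rewrite [F i j]ij.
Qed.

Lemma hprod_const (I : finType) (F : sgraph I) (T : Type) (p : R) (x : I -> T) :
  hprod F (fun _ _ => p) x = p ^+ num_edges F.
Proof. by rewrite /hprod prodr_const card_epair. Qed.

Lemma card_setE (T : finType) (Q : pred T) : #|[set x | Q x]%SET|%:R = \sum_x ((Q x)%:R : R).
Proof.
rewrite -sum1_card natr_sum big_mkcond /=; apply: eq_bigr => x _.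
by rewrite inE; case: (Q x).
Qed.

Lemma N_sum (I V : finType) (F : sgraph I) (G : sgraph V) :
  (N F G)%:R = \sum_(x : {ffun I -> V}) (injectiveb x)%:R * hprod F (gadj G) x.
Proof.
rewrite /N /inj_homs card_setE; apply: eq_bigr => x _.
by rewrite hprod_gadj; case: (injectiveb x); rewrite /= ?mul1r ?mul0r.
Qed.

Lemma disjoint_inj (I V : finType) (U : I -> {set V}) (x : {ffun I -> V}) :
  (forall i j, i != j -> [disjoint U i & U j]%B) -> (forall i, x i \in U i) ->
  injectiveb x.
Proof.
move=> dU xU; apply/injectiveP => i j e; apply/eqP; apply: contraT => ij.
by have /pred0P/(_ (x i)) := dU _ _ ij; rewrite /= xU e xU.
Qed.

(** Membership in disjoint sets already forces injectivity, so that, unlike for [N], no error from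
    non-injective maps arises. *)
Lemma NU_sum (m : nat) (V : finType) (F : sgraph 'I_m) (G : sgraph V) (U : 'I_m -> {set V}) :
  (forall i j, i != j -> [disjoint U i & U j]%B) ->
  (NU F G U)%:R = \sum_(x : {ffun 'I_m -> V}) hprod F (gadj G) x * \prod_i (x i \in U i)%:R.
Proof.
move=> dU; rewrite /NU card_setE; apply: eq_bigr => x _; rewrite inE hprod_gadj.
have -> : \prod_i ((x i \in U i)%:R : R) = [forall i, x i \in U i]%:R by exact: prod_bool.
case: (boolP [forall i, x i \in U i]) => [/forallP xU|_]; last by rewrite andbF mulr0.
by rewrite (disjoint_inj dU xU) andbT mulr1.
Qed.

Lemma sum_prod_mem (I V : finType) (U : I -> {set V}) :
  \sum_(x : {ffun I -> V}) \prod_i ((x i \in U i)%:R : R) = \prod_i #|U i|%:R.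
Proof.
rewrite -(bigA_distr_bigA (fun i v => ((v \in U i)%:R : R))).
apply: eq_bigr => i _; rewrite -card_setE; congr (_%:R); apply: eq_card => v.
by rewrite inE.
Qed.

Lemma NU_counting (m : nat) (V : finType) (F : sgraph 'I_m) (G : sgraph V)
    (U : 'I_m -> {set V}) (p d : R) : (0 < #|V|)%N -> unit_itv p ->
  (forall i j, i != j -> [disjoint U i & U j]%B) ->
  cut_le (fun x y => gadj G x y - p) (d * #|V|%:R ^+ 2) ->
  `|(NU F G U)%:R - p ^+ num_edges F * \prod_i #|U i|%:R|
    <= (num_edges F)%:R * d * #|V|%:R ^+ m.
Proof.
move=> V0 pU dU cut; rewrite NU_sum // -sum_prod_mem mulr_sumr -sumrB.
have aU (k : 'I_m) (x : V) : unit_itv ((x \in U k)%:R : R).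
  by rewrite /unit_itv ler0n lern1; case: (x \in _).
have := @counting R _ F V (gadj G) (fun _ _ => p) _ d V0 (@gadj_unit _ G) (fun _ _ => pU) aU cut.
rewrite card_ord; congr (`|_| <= _); apply: eq_bigr => x _.
by rewrite hprod_const mulrBl.
Qed.

Lemma N_counting (I V : finType) (F : sgraph I) (G : sgraph V)
   (p d : R) : (0 < #|V|)%N -> unit_itv p ->
  cut_le (fun x y => gadj G x y - p) (d * #|V|%:R ^+ 2) ->
  `|(N F G)%:R - p ^+ num_edges F * #|V|%:R ^+ #|I| |
    <= ((num_edges F)%:R * d + #|I|%:R ^+ 2 / #|V|%:R) * #|V|%:R ^+ #|I|.
Proof.
move=> V0 pU cut; have n0 : 0 < (#|V|%:R : R) by rewrite ltr0n.
have oneU (k : I) (x : V) : unit_itv (1 : R) by rewrite /unit_itv ler01 lexx.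
have := @counting R _ F V (gadj G) (fun _ _ => p) _ d V0 (@gadj_unit _ G) (fun _ _ => pU) oneU cut.
set A := (X in `|X| <= _) => le1.
have -> : (N F G)%:R - p ^+ num_edges F * #|V|%:R ^+ #|I| =
   A - \sum_(x : {ffun I -> V}) (~~ injectiveb x)%:R * hprod F (gadj G) x.
  rewrite N_sum -sum_ffun1 mulr_sumr /A -!sumrB; apply: eq_bigr => x _.
  rewrite hprod_const big1 ?mulr1 //; case: (injectiveb x); rewrite /= ?mul1r ?mul0r.
    by rewrite subr0.
  by rewrite sub0r addrAC subrr sub0r.
apply: le_trans (ler_normB _ _) _; rewrite mulrDl; apply: lerD => //.
apply: (@le_trans _ _ (\sum_(x : {ffun I -> V}) (~~ injectiveb x)%:R)).
  apply: le_trans (ler_norm_sum _ _ _) _; apply: ler_sum => x _.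
  have /andP[h0 h1] := hprod_unit F x (@gadj_unit _ G).
  by rewrite normrM normr_nat ger0_norm // ler_piMr.
exact: sum_noninj.
Qed.

End GraphCounts.

(** * Properties of sequences that follow from a small cut norm *)

Section Sequences.
Local Open Scope classical_set_scope.
Local Open Scope ring_scope.
Variables (R : realType) (p : R) (G : nat -> graph).
Hypotheses (p_gt0 : 0 < p) (p_le1 : p <= 1).
Hypothesis Goo : order_to_infinity G.

Definition cut_random := forall d : R, 0 < d -> \forall n \near \oo,
  cut_le (fun x y => gadj R (G n) x y - p) (d * (num_vertices (G n))%:R ^+ 2).

Lemma near_order (k : nat) : \forall n \near \oo, (k <= num_vertices (G n))%N.
Proof. exact: (Goo (nbhs_infty_ge k)). Qed.

Lemma near_order_invr (e : R) : 0 < e ->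
  \forall n \near \oo, (0 < num_vertices (G n))%N && ((num_vertices (G n))%:R^-1 <= e).
Proof.
move=> e0; have [k kP] : exists k : nat, e^-1 <= k%:R.
  by exists (Num.truncn e^-1).+1; exact/ltW/truncnS_gt.
apply: filterS (near_order k.+1) => n kn.
have n0 : (0 < num_vertices (G n))%N by exact: leq_trans kn.
rewrite n0 /= -[leRHS]invrK lef_pV2 ?posrE ?invr_gt0 ?ltr0n //.
by apply: le_trans kP _; rewrite ler_nat ltnW.
Qed.

Let pU : unit_itv p. Proof. by rewrite /unit_itv ltW. Qed.

Lemma P_of_cut (m : nat) (F : sgraph 'I_m) (alpha : 'I_m -> R) :
  cut_random -> P p F alpha G.
Proof.
move=> cut e e0.
have d0 : 0 < e / (num_edges F).+1%:R by rewrite divr_gt0 // ltr0n.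
apply: filterS2 (near_order 1) (cut _ d0) => n n0 cn U [dU _].
apply: le_trans (NU_counting _ n0 pU dU cn) _.
rewrite ler_wpM2r ?exprn_ge0 ?ler0n // mulrCA ler_piMr ?(ltW e0) //.
by rewrite ler_pdivrMr ?ltr0n // mul1r ler_nat.
Qed.

Lemma Ptilde_of_cut (m : nat) (F : sgraph 'I_m) (alpha : 'I_m -> R) :
  cut_random -> Ptilde p F alpha G.
Proof.
move=> cut e e0.
have d0 : 0 < e / (num_edges F).+1%:R by rewrite divr_gt0 // ltr0n.
apply: filterS2 (near_order 1) (cut _ d0) => n n0 cn U [dU _].
rewrite /NUtilde -{1}[m]card_ord; apply: perm_average_le => s.
have dUs i j : i != j -> [disjoint U (s i) & U (s j)]%B.
  by move=> ij; apply: dU; rewrite (inj_eq perm_inj).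
rewrite (reindex_inj (@perm_inj _ s)) /=.
apply: le_trans (NU_counting _ n0 pU dUs cn) _.
rewrite ler_wpM2r ?exprn_ge0 ?ler0n // mulrCA ler_piMr ?(ltW e0) //.
by rewrite ler_pdivrMr ?ltr0n // mul1r ler_nat.
Qed.

Lemma quasi_random_of_cut : cut_random -> quasi_random p G.
Proof.
move=> cut W F e e0.
(* Half of [e] pays for the cut norm, half for the non-injective maps; the successors keep the
   divisors positive for an edgeless or empty graph. *)
have d0 : 0 < e / 2 / (num_edges F).+1%:R by rewrite !divr_gt0 // ltr0n.
have d1 : 0 < e / 2 / (#|W|.+1)%:R ^+ 2 by rewrite !divr_gt0 // exprn_gt0 // ltr0n.
apply: filterS2 (near_order_invr d1) (cut _ d0) => n /andP[n0 ne] cn.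
apply: le_trans (N_counting _ n0 pU cn) _.
rewrite ler_wpM2r ?exprn_ge0 ?ler0n // [leRHS](_ : _ = e / 2 + e / 2); last by field.
apply: lerD.
  rewrite mulrCA ler_piMr ?divr_ge0 ?(ltW e0) //.
  by rewrite ler_pdivrMr ?ltr0n // mul1r ler_nat.
apply: (@le_trans _ _ (#|W|%:R ^+ 2 * (e / 2 / (#|W|.+1)%:R ^+ 2))).
  by rewrite ler_wpM2l // exprn_ge0 // ler0n.
rewrite mulrCA ler_piMr ?divr_ge0 ?(ltW e0) //.
rewrite ler_pdivrMr ?exprn_gt0 ?ltr0n // mul1r lerXn2r ?nnegrE ?ler0n // ler_nat.
by [].
Qed.

End Sequences.

(** * Quasi-randomness bounds the cut norm *)

Section FourCycles.
Variables (R : realType) (V : finType).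

(** Cauchy-Schwarz, read off from the nonnegative sum of the squares of [n * b i - s], where [b] is
    [a] set to 0 outside [A]. *)
Lemma sqr_sum_le (T : finType) (A : {pred T}) (a : T -> R) :
  (\sum_(i in A) a i) ^+ 2 <= #|T|%:R * \sum_i a i ^+ 2.
Proof.
pose b i := if i \in A then a i else 0.
have -> : \sum_(i in A) a i = \sum_i b i by rewrite big_mkcond.
apply: (@le_trans _ _ (#|T|%:R * \sum_i b i ^+ 2)); last first.
  rewrite ler_wpM2l ?ler0n //; apply: ler_sum => i _; rewrite /b.
  by case: ifP => // _; rewrite expr0n sqr_ge0.
have [T0|T0] := posnP #|T|.
  by rewrite T0 mul0r big1 ?expr0n // => i _; have := fintype0 i T0.
have n0 : 0 < (#|T|%:R : R) by rewrite ltr0n.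
set s := \sum_i b i; set n := #|T|%:R.
have : 0 <= \sum_i (n * b i - s) ^+ 2 by apply: sumr_ge0 => i _; exact: sqr_ge0.
have -> : \sum_i (n * b i - s) ^+ 2 = n * (n * (\sum_i b i ^+ 2) - s ^+ 2).
  rewrite (eq_bigr (fun i => (n ^+ 2 * b i ^+ 2 - 2 * n * s * b i) + s ^+ 2)); last by move=> i _; ring.
  rewrite big_split /= sumr_const -[s ^+ 2 *+ _]mulr_natl -/n sumrB -!mulr_sumr -/s.
  by ring.
by rewrite pmulr_rge0 // subr_ge0.
Qed.

Lemma prodrD_set (I : finType) (f g : I -> R) :
  \prod_i (f i + g i) = \sum_(J : {set I}) \prod_i (if i \in J then f i else g i).
Proof. by rewrite bigA_distr; apply: eq_bigl. Qed.

(* C_4 is seen as K_{2,2}, each side being indexed by [bool]. *)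
Definition c4 (h : V -> V -> R) : R :=
  \sum_(x : {ffun (bool + bool)%type -> V}) \prod_(ab : bool * bool) h (x (inl ab.1)) (x (inr ab.2)).

Lemma sum_ffun_sum (A B : finType) (phi : {ffun (A + B)%type -> V} -> R) :
  \sum_x phi x = \sum_(l : {ffun A -> V}) \sum_(r : {ffun B -> V})
     phi [ffun i => match i with inl a => l a | inr b => r b end].
Proof.
rewrite pair_big /=.
rewrite (reindex (fun q : {ffun A -> V} * {ffun B -> V} =>
   [ffun i => match i with inl a => q.1 a | inr b => q.2 b end])) //=.
exists (fun x => ([ffun a => x (inl a)], [ffun b => x (inr b)])) => [[l r] _|x _] /=.
  by congr (_, _); apply/ffunP => i; rewrite !ffunE.
by apply/ffunP => -[a|b]; rewrite !ffunE.
Qed.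

(** Once the two vertices [l] of one side are fixed, the two of the other side range independently
    over the same sum. *)
Lemma c4E (h : V -> V -> R) :
  c4 h = \sum_(l : {ffun bool -> V}) (\sum_y \prod_a h (l a) y) ^+ 2.
Proof.
rewrite /c4 sum_ffun_sum; apply: eq_bigr => l _.
rewrite (_ : _ ^+ 2 = \prod_(b : bool) \sum_y \prod_a h (l a) y); last first.
  by rewrite prodr_const card_bool.
rewrite bigA_distr_bigA /=; apply: eq_bigr => r _; rewrite exchange_big /= pair_big /=.
by apply: eq_bigr => -[a b] _; rewrite !ffunE.
Qed.

(** Cauchy-Schwarz twice: over [y], which drops [T], and then over the pairs [l] in [S], which drops
    [S]. The terms added on the way are squares. *)
Lemma cut_le_c4 (h : V -> V -> R) (S T : {set V}) :
  (\sum_(x in S) \sum_(y in T) h x y) ^+ 4 <= #|V|%:R ^+ 4 * c4 h.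
Proof.
rewrite exchange_big /=.
have := sqr_sum_le (mem T) (fun y => \sum_(x in S) h x y).
set A := \sum_(y in T) _ => le1.
have e1 : \sum_y (\sum_(x in S) h x y) ^+ 2 =
    \sum_(l : {ffun bool -> V} | l \in ffun_on (mem S)) \sum_y \prod_a h (l a) y.
  rewrite exchange_big /=; apply: eq_bigr => y _.
  rewrite (_ : _ ^+ 2 = \prod_(b : bool) \sum_(x in S) h x y); last first.
    by rewrite prodr_const card_bool.
  by rewrite bigA_distr_big.
rewrite e1 in le1.
have := sqr_sum_le (mem (ffun_on (mem S))) (fun l : {ffun bool -> V} => \sum_y \prod_a h (l a) y).
rewrite -c4E card_ffun card_bool natrX.
set B := \sum_(l in _) _ => le2.
rewrite [_ ^+ 4](_ : _ = (A ^+ 2) ^+ 2); last by rewrite -exprM.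
apply: (@le_trans _ _ ((#|V|%:R * B) ^+ 2)).
  by rewrite lerXn2r ?nnegrE ?sqr_ge0 // (le_trans (sqr_ge0 A)).
rewrite exprMn; apply: le_trans (ler_wpM2l (sqr_ge0 _) le2) _.
by rewrite mulrA -exprD.
Qed.

(** All sixteen subgraphs keep the four vertices of C_4, so that their counts are compared with the
    same n^4 and can be combined linearly. *)
Definition c4sub_rel (J : {set bool * bool}) : rel (bool + bool) := fun u v =>
  match u, v with
  | inl a, inr b => (a, b) \in J
  | inr b, inl a => (a, b) \in J
  | _, _ => false
  end.

Lemma c4sub_sym J : symmetric (c4sub_rel J). Proof. by case=> a [b|b]. Qed.
Lemma c4sub_irr J : irreflexive (c4sub_rel J). Proof. by case. Qed.
Definition c4sub J : sgraph (bool + bool)%type := SGraph (@c4sub_sym J) (@c4sub_irr J).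

Lemma num_edges_c4sub J : num_edges (c4sub J) = #|J|.
Proof.
rewrite /num_edges -(card_in_imset (f := fun e : bool * bool => [set inl e.1; inr e.2]%SET : {set bool + bool})).
  apply: eq_card => s; rewrite inE.
  apply/existsP/imsetP => [[u /existsP[v /andP[uv /eqP ->]]]|[[a b] abJ ->]].
    case: u v uv => [a|b] [b'|a'] //= uv; first by exists (a, a').
    by exists (b', b) => //; rewrite finset.setUC.
  by exists (inl a); apply/existsP; exists (inr b); rewrite /= abJ eqxx.
move=> [a b] [c d] _ _ /= /setP E; congr (_, _).
  by have := E (inl a); rewrite !inE !eqxx /= orbF => /esym/eqP[].
by have := E (inr b); rewrite !inE !eqxx /= => /esym/eqP[].
Qed.

Lemma hprod_c4sub (G : sgraph V) J (x : (bool + bool)%type -> V) :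
  hprod (c4sub J) (gadj R G) x =
  \prod_(ab in J) gadj R G (x (inl ab.1)) (x (inr ab.2)).
Proof.
rewrite hprod_gadj /gadj prod_bool; congr (_%:R); congr nat_of_bool.
apply/forallP/forallP => [H [a b]|H u].
  by have /forallP/(_ (inr b)) := H (inl a).
apply/forallP => v; apply/implyP; case: u v => [a|b] [b'|a'] //= uv.
  by have := H (a, a'); rewrite /= uv.
by have := H (b', b); rewrite /= uv /= adj_sym.
Qed.

(** The product of [G - p] over the four edges expands into one signed term per subgraph [J], and
    the main terms add up to the expansion of (p - p)^4 = 0. The outer 16 counts the subgraphs; the
    inner one is 4^2, from the non-injective maps. *)
Lemma c4_small (G : sgraph V) (p e : R) : (0 < #|V|)%N -> unit_itv p -> 
  (forall J, `|(N (c4sub J) G)%:R - p ^+ #|J| * #|V|%:R ^+ 4| <= e * #|V|%:R ^+ 4) ->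
  c4 (fun x y => gadj R G x y - p) <= 16 * (e + 16 / #|V|%:R) * #|V|%:R ^+ 4.
Proof.
move=> V0 pU HJ; have n0 : 0 < (#|V|%:R : R) by rewrite ltr0n.
have card4 : #|{: bool + bool}| = 4 by rewrite card_sum card_bool.
pose A J := \sum_(x : {ffun (bool + bool)%type -> V}) hprod (c4sub J) (gadj R G) x.
have HA J : `|A J - p ^+ #|J| * #|V|%:R ^+ 4| <= (e + 16 / #|V|%:R) * #|V|%:R ^+ 4.
  have -> : A J - p ^+ #|J| * #|V|%:R ^+ 4 = ((N (c4sub J) G)%:R - p ^+ #|J| * #|V|%:R ^+ 4)
     + \sum_(x : {ffun (bool + bool)%type -> V}) (~~ injectiveb x)%:R * hprod (c4sub J) (gadj R G) x.
    rewrite N_sum addrAC -big_split /=; congr (_ - _); apply: eq_bigr => x _.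
    by case: (injectiveb x); rewrite /= ?mul1r ?mul0r ?addr0 ?add0r.
  apply: le_trans (ler_normD _ _) _; rewrite mulrDl; apply: lerD => //.
  apply: (@le_trans _ _ (\sum_(x : {ffun (bool + bool)%type -> V}) (~~ injectiveb x)%:R)).
    apply: le_trans (ler_norm_sum _ _ _) _; apply: ler_sum => x _.
    have /andP[h0 h1] := hprod_unit (c4sub J) x (@gadj_unit R _ G).
    by rewrite normrM normr_nat ger0_norm // ler_piMr.
  by have := sum_noninj R (bool + bool)%type V0; rewrite card4 -natrX.
pose c (J : {set bool * bool}) : R := (- p) ^+ #|~: J|%SET.
have cE (J : {set bool * bool}) (f : bool * bool -> R) :
   \prod_ab (if ab \in J then f ab else - p) = (\prod_(ab in J) f ab) * c J.
  rewrite (bigID (fun ab => ab \in J)) /=; congr (_ * _).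
    by apply: eq_bigr => ab ->.
  rewrite (eq_bigr (fun=> - p)); last by move=> ab /negPf ->.
  by rewrite prodr_const; congr (_ ^+ _); apply: eq_card => ab; rewrite !inE.
have -> : c4 (fun x y => gadj R G x y - p) =
    \sum_(J : {set bool * bool}) (A J - p ^+ #|J| * #|V|%:R ^+ 4) * c J.
  have -> : \sum_(J : {set bool * bool}) (A J - p ^+ #|J| * #|V|%:R ^+ 4) * c J =
     \sum_(J : {set bool * bool}) A J * c J -
     #|V|%:R ^+ 4 * \sum_(J : {set bool * bool}) p ^+ #|J| * c J.
    by rewrite mulr_sumr -sumrB; apply: eq_bigr => J _; ring.
  have -> : \sum_(J : {set bool * bool}) p ^+ #|J| * c J = 0.
    transitivity (\prod_(ab : bool * bool) (p + - p)); last first.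
      by rewrite prodr_const subrr expr0n card_prod card_bool.
    by rewrite prodrD_set; apply: eq_bigr => J _; rewrite cE prodr_const.
  rewrite mulr0 subr0 /c4.
  rewrite (eq_bigr (fun x : {ffun (bool + bool)%type -> V} => \sum_(J : {set bool * bool}) hprod (c4sub J) (gadj R G) x * c J)).
    by rewrite exchange_big /=; apply: eq_bigr => J _; rewrite mulr_suml.
  by move=> x _; rewrite prodrD_set; apply: eq_bigr => J _; rewrite cE hprod_c4sub.
apply: le_trans (ler_norm _) _; apply: le_trans (ler_norm_sum _ _ _) _.
apply: (@le_trans _ _ (\sum_(J : {set bool * bool}) (e + 16 / #|V|%:R) * #|V|%:R ^+ 4)).
  apply: ler_sum => J _; rewrite normrM -[leRHS]mulr1.
  apply: ler_pM => //; rewrite normrX normrN exprn_ile1 //.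
  by rewrite ger0_norm //; have /andP[] := pU.
rewrite sumr_const -mulrA -[leLHS]mulr_natl.
rewrite (_ : #|_| = 16) //.
have := card_powerset [set: bool * bool]%SET; rewrite cardsT card_prod card_bool => E.
by rewrite -[RHS]E; apply: eq_card => J; rewrite !inE finset.subsetT.
Qed.

End FourCycles.

Section QuasiCut.
Local Open Scope classical_set_scope.
Local Open Scope ring_scope.
Variables (R : realType) (p : R) (G : nat -> graph).
Hypotheses (p_gt0 : 0 < p) (p_le1 : p <= 1).
Hypothesis Goo : order_to_infinity G.

Lemma cut_of_quasi_random : quasi_random p G -> cut_random p G.
Proof.
move=> qr d d0.
have pU : unit_itv p by rewrite /unit_itv ltW.
(* The two errors add up to [d ^+ 4] in [c4_small], since 16 (1/32 + 16/512) = 1. *)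
have e0 : 0 < d ^+ 4 / 32 by rewrite divr_gt0 ?exprn_gt0.
have e1 : 0 < d ^+ 4 / 512 by rewrite divr_gt0 ?exprn_gt0.
have HJ : \forall n \near \oo, forall J,
  `|(N (c4sub J) (G n))%:R - p ^+ #|J| * (num_vertices (G n))%:R ^+ 4|
     <= d ^+ 4 / 32 * (num_vertices (G n))%:R ^+ 4.
  apply: filter_forall => J; have := qr _ (c4sub J) _ e0.
  by apply: filterS => n; rewrite num_edges_c4sub card_sum card_bool.
apply: filterS2 (near_order_invr Goo e1) HJ => n /andP[n0 ne] Hn S T.
have := c4_small n0 pU Hn; set c := c4 _ => cle.
have nn : 0 <= d * (num_vertices (G n))%:R ^+ 2 by rewrite mulr_ge0 ?(ltW d0) ?exprn_ge0 ?ler0n.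
rewrite -(@ler_pXn2r _ 4) ?nnegrE //.
rewrite -normrX ger0_norm; last by rewrite (exprM _ 2 2) sqr_ge0.
apply: le_trans (cut_le_c4 _ _ _) _.
rewrite exprMn -exprM.
apply: (@le_trans _ _ ((num_vertices (G n))%:R ^+ 4 * (d ^+ 4 * (num_vertices (G n))%:R ^+ 4))).
  rewrite ler_wpM2l ?exprn_ge0 ?ler0n //; apply: le_trans cle _.
  rewrite ler_wpM2r ?exprn_ge0 ?ler0n //.
  rewrite -/(num_vertices (G n)).
  move: ne; set z := _^-1; set D := d ^+ 4 => ne.
  by lra.
by rewrite mulrCA -exprD.
Qed.

End QuasiCut.

(** * Strong regularity for matrices *)

Section CondExp.
Variables (R : realType) (X : finType).

Definition refines (C C' : finType) (c : X -> C) (c' : X -> C') :=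
  forall x y, c' x = c' y -> c x = c y.

Definition condexp (C : finType) (c : X -> C) (h : X -> R) (x : X) : R :=
  (\sum_(y | c y == c x) h y) / #|[pred y | c y == c x]|%:R.

Definition energy (C : finType) (c : X -> C) (h : X -> R) : R :=
  \sum_x condexp c h x ^+ 2.

Lemma card_class_gt0 (C : finType) (c : X -> C) x : 0 < (#|[pred y | c y == c x]|%:R : R).
Proof. by rewrite ltr0n; apply/card_gt0P; exists x; rewrite inE. Qed.

Lemma condexp_class (C : finType) (c : X -> C) h x y :
  c x = c y -> condexp c h x = condexp c h y.
Proof. by rewrite /condexp => ->. Qed.

Lemma condexp_unit (C : finType) (c : X -> C) h x :
  (forall x, unit_itv (h x)) -> unit_itv (condexp c h x).
Proof.
move=> hU; have c0 := card_class_gt0 c x; apply/andP; split.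
  by rewrite divr_ge0 ?(ltW c0) // sumr_ge0 // => y _; have /andP[] := hU y.
rewrite ler_pdivrMr // mul1r -sum1_card natr_sum.
by apply: ler_sum => y _; have /andP[] := hU y.
Qed.

Lemma sum_condexp (C : finType) (c : X -> C) h (s : X -> R) :
  (forall x y, c x = c y -> s x = s y) ->
  \sum_x condexp c h x * s x = \sum_x h x * s x.
Proof.
move=> sc.
pose k x : R := #|[pred y | c y == c x]|%:R.
have -> : \sum_x condexp c h x * s x = \sum_x \sum_(y | c y == c x) h y * s y / k y.
  apply: eq_bigr => x _; rewrite /condexp !mulr_suml; apply: eq_bigr => y /eqP e.
  by rewrite (sc _ _ e) /k e mulrAC.
rewrite (exchange_big_dep xpredT) //=; apply: eq_bigr => y _.
rewrite (eq_bigl (fun x => c x == c y)); last by move=> x; rewrite eq_sym.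
rewrite sumr_const -[LHS]mulr_natr.
by rewrite divfK // gt_eqF // card_class_gt0.
Qed.

(** Pythagoras: averaging over the coarser classes is an orthogonal projection, so [condexp c h] is
    orthogonal to the increment [condexp c' h - condexp c h]. *)
Lemma energy_diff (C C' : finType) (c : X -> C) (c' : X -> C') h : refines c c' ->
  \sum_x (condexp c' h x - condexp c h x) ^+ 2 = energy c' h - energy c h.
Proof.
move=> cc'.
have e1 : \sum_x condexp c' h x * condexp c h x = energy c h.
  rewrite (sum_condexp (c := c')); last by move=> x y /cc'/condexp_class.
  rewrite -(sum_condexp (c := c)); last by move=> x y /condexp_class.
  by apply: eq_bigr => x _; rewrite expr2.
rewrite (eq_bigr (fun x => condexp c' h x ^+ 2 + condexp c h x ^+ 2 -
   2 * (condexp c' h x * condexp c h x))); last by move=> x _; ring.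
rewrite sumrB big_split /= -mulr_sumr e1 -/(energy c' h) -/(energy c h).
by ring.
Qed.

Lemma energy_le (C : finType) (c : X -> C) h :
  (forall x, unit_itv (h x)) -> energy c h <= #|X|%:R.
Proof.
move=> hU; rewrite -sum1_card natr_sum; apply: ler_sum => x _.
have /andP[h0 h1] := condexp_unit c x hU.
by rewrite exprn_ile1.
Qed.

Lemma energy_mono (C C' : finType) (c : X -> C) (c' : X -> C') h : refines c c' ->
  energy c h <= energy c' h.
Proof.
by move/(energy_diff h) => e; rewrite -subr_ge0 -e sumr_ge0 // => x _; exact: sqr_ge0.
Qed.

End CondExp.

(** * Weak and strong regularity by energy increment *)

Section Regularity.
Variable R : realType.

Definition pairmap (V C : finType) (c : V -> C) (q : V * V) := (c q.1, c q.2).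

Definition stepw (V : finType) (g : V -> V -> R) (C : finType) (c : V -> C) (x y : V) : R :=
  condexp (pairmap c) (fun q => g q.1 q.2) (x, y).

Definition sten (V : finType) (g : V -> V -> R) (C : finType) (c : V -> C) : R :=
  energy (pairmap c) (fun q => g q.1 q.2).

Lemma refines_pair (V C C' : finType) (c : V -> C) (c' : V -> C') :
  refines c c' -> refines (pairmap c) (pairmap c').
Proof. by move=> cc' [x y] [x' y'] [/cc' e1 /cc' e2]; rewrite /pairmap /= e1 e2. Qed.

(** Since [c'] separates [S] and [T], averaging over its classes preserves the sum of [g] over the
    rectangle, so the discrepancy is a sum of differences of the two conditional expectations.
    Cauchy-Schwarz over the n^2 pairs and Pythagoras bound its square by n^2 times the gain of
    energy. *)
Lemma energy_step (V C C' : finType) (g : V -> V -> R) (c : V -> C) (c' : V -> C')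
    (S T : {set V}) (f : R) : (0 < #|V|)%N -> 0 <= f ->
  refines c c' -> refines (fun x => (x \in S, x \in T)) c' ->
  f * #|V|%:R ^+ 2 <= `|\sum_(x in S) \sum_(y in T) (g x y - stepw g c x y)| ->
  sten g c + f ^+ 2 * #|V|%:R ^+ 2 <= sten g c'.
Proof.
move=> V0 f0 cc' sc' big; have n0 : 0 < (#|V|%:R : R) by rewrite ltr0n.
pose h (q : V * V) := g q.1 q.2.
pose A := [pred q : V * V | (q.1 \in S) && (q.2 \in T)].
have e1 : \sum_(x in S) \sum_(y in T) (g x y - stepw g c x y) =
    \sum_(q in A) (condexp (pairmap c') h q - condexp (pairmap c) h q).
  rewrite pair_big /= (eq_bigr (fun q => h q - condexp (pairmap c) h q)); last by case.
  rewrite !sumrB; congr (_ - _); rewrite big_mkcond [RHS]big_mkcond /=.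
  transitivity (\sum_q h q * (q \in A)%:R).
    by apply: eq_bigr => q _; rewrite inE; case: ifP; rewrite ?mulr1 ?mulr0.
  rewrite -(sum_condexp (c := pairmap c')).
    by apply: eq_bigr => q _; rewrite inE; case: ifP; rewrite ?mulr1 ?mulr0.
  move=> [x y] [x' y'] [ /sc' [e1 _] /sc' [_ e2]]; by rewrite !inE /= e1 e2.
have := sqr_sum_le (mem A) (fun q => condexp (pairmap c') h q - condexp (pairmap c) h q).
rewrite -e1 (energy_diff _ (refines_pair cc')) -/(sten g c) -/(sten g c') card_prod natrM.
set s := \sum_(x in S) _ in big *.
have le2 : (f * #|V|%:R ^+ 2) ^+ 2 <= s ^+ 2.
  rewrite -(real_normK (num_real s)).
  by rewrite lerXn2r ?nnegrE ?normr_ge0 ?mulr_ge0 ?exprn_ge0 ?ler0n.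
move=> /(le_trans le2); rewrite -expr2 -lerBrDl exprMn -exprM.
rewrite (_ : f ^+ 2 * _ ^+ (2 * 2) = #|V|%:R ^+ 2 * (f ^+ 2 * #|V|%:R ^+ 2)); last by ring.
by rewrite ler_pM2l // exprn_gt0.
Qed.

(** While the cut norm is too large, a witness [S], [T] is recorded in the colour of each vertex,
    which multiplies the number of values of [d] by 4. The map [c] stays as first component so that
    the result refines it. *)
Lemma weak_regularity_step (V : finType) (g : V -> V -> R) (f : R) (C : finType)
    (c : V -> C) (k : nat) : (0 < #|V|)%N -> 0 <= f ->
  exists (D : finType) (d : V -> D), (#|D| <= 4 ^ k)%N /\
    (cut_le (fun x y => g x y - stepw g (fun v => (c v, d v)) x y) (f * #|V|%:R ^+ 2) \/
     sten g c + k%:R * (f ^+ 2 * #|V|%:R ^+ 2) <= sten g (fun v => (c v, d v))).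
Proof.
move=> V0 f0; elim: k => [|k [D [d [Dk IH]]]].
  exists unit, (fun=> tt); split; first by rewrite card_unit.
  by right; rewrite mul0r addr0; apply/energy_mono/refines_pair => x y [].
case: IH => [cut|le].
  exists D, d; split; last by left.
  by rewrite (leq_trans Dk) // leq_exp2l.
case: (pselect (cut_le (fun x y => g x y - stepw g (fun v => (c v, d v)) x y)
   (f * #|V|%:R ^+ 2))) => [cut|].
  exists D, d; split; last by left.
  by rewrite (leq_trans Dk) // leq_exp2l.
move=> /existsNP[S /existsNP[T /negP]]; rewrite -ltNge => /ltW big.
exists (D * (bool * bool))%type, (fun v => (d v, (v \in S, v \in T))); split.
  by rewrite !card_prod card_bool expnSr leq_mul.
right; rewrite -addn1 natrD mulrDl mul1r addrA.
apply: le_trans (lerD le (lexx _)) _.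
by apply: (energy_step V0 f0 _ _ big) => [x y [-> -> _ _]|x y [_ _ -> ->]].
Qed.

Lemma stepw_unit (V : finType) (g : V -> V -> R) (C : finType) (c : V -> C) x y :
  (forall x y, unit_itv (g x y)) -> unit_itv (stepw g c x y).
Proof. by move=> gU; apply: condexp_unit => -[]. Qed.

Lemma sten_le (V : finType) (g : V -> V -> R) (C : finType) (c : V -> C) :
  (forall x y, unit_itv (g x y)) -> sten g c <= #|V|%:R ^+ 2.
Proof.
move=> gU; have := @energy_le R _ _ (pairmap c) (fun q => g q.1 q.2).
by rewrite card_prod natrM -expr2; apply=> -[].
Qed.

(** After this many increments of size [e] times n^2 the energy would exceed its maximum n^2. *)
Definition nsteps (e : R) : nat := (Num.truncn e^-1).+1.

Lemma nsteps_gt1 (e : R) : 0 < e -> 1 < (nsteps e)%:R * e.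
Proof.
move=> e0; rewrite -ltr_pdivrMr // mul1r.
by exact: truncnS_gt.
Qed.

Lemma weak_regularity (V : finType) (g : V -> V -> R) (f : R) (C : finType) (c : V -> C) :
  (0 < #|V|)%N -> 0 < f -> (forall x y, unit_itv (g x y)) ->
  exists (D : finType) (d : V -> D), (#|D| <= 4 ^ nsteps (f ^+ 2))%N /\
    cut_le (fun x y => g x y - stepw g (fun v => (c v, d v)) x y) (f * #|V|%:R ^+ 2).
Proof.
move=> V0 f0 gU; have n0 : 0 < (#|V|%:R : R) by rewrite ltr0n.
have [D [d [Dk [cut|le]]]] := weak_regularity_step g c (nsteps (f ^+ 2)) V0 (ltW f0).
  by exists D, d.
have := le_trans le (sten_le _ gU).
have s0 : 0 <= sten g c by apply: sumr_ge0 => q _; exact: sqr_ge0.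
move=> /(le_trans (lerD s0 (lexx _))); rewrite add0r mulrA -[leRHS]mul1r.
rewrite ler_pM2r ?exprn_gt0 // leNgt nsteps_gt1 //.
by rewrite exprn_gt0.
Qed.

(** Weak regularity refines [c] to precision [f #|C|]. Either the refinement is close to [c] in L^2
    and both are returned, or its energy is larger by at least [e] times n^2 and it takes the place
    of [c]. *)
Lemma strong_regularity_step (e : R) (f : nat -> R) (k : nat) : 0 < e ->
  (forall j, 0 < f j) ->
  exists K : nat, forall (V : finType) (g : V -> V -> R),
    (0 < #|V|)%N -> (forall x y, unit_itv (g x y)) ->
  exists (C : finType) (c : V -> C), (#|C| <= K)%N /\
   ((exists (D : finType) (d : V -> D),
      cut_le (fun x y => g x y - stepw g d x y) (f #|C| * #|V|%:R ^+ 2) /\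
      \sum_x \sum_y (stepw g d x y - stepw g c x y) ^+ 2 <= e * #|V|%:R ^+ 2)
    \/ k%:R * (e * #|V|%:R ^+ 2) <= sten g c).
Proof.
move=> e0 f0; elim: k => [|k [K IH]].
  exists 1%N => V g V0 gU; exists unit, (fun=> tt); split; first by rewrite card_unit.
  by right; rewrite mul0r; apply: sumr_ge0 => q _; exact: sqr_ge0.
(* Only [#|C| <= K] is known when the bound is fixed, so the sum covers every possible value of
   [#|C|]. *)
exists (K * \sum_(j < K.+1) 4 ^ nsteps (f j ^+ 2))%N => V g V0 gU.
have [C [c [CK [good|le]]]] := IH V g V0 gU.
  exists C, c; split; last by left.
  apply: leq_trans CK _; rewrite -[leqLHS]muln1 leq_mul //.
  by rewrite big_ord_recl addn_gt0 expn_gt0.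
have [D [d [Dk cut]]] := weak_regularity c V0 (f0 #|C|) gU.
have cd : refines c (fun v => (c v, d v)) by move=> x y [].
set S := \sum_x \sum_y (stepw g (fun v => (c v, d v)) x y - stepw g c x y) ^+ 2.
have SE : S = sten g (fun v => (c v, d v)) - sten g c.
  by rewrite /S pair_big /= -(energy_diff _ (refines_pair cd)); apply: eq_bigr => -[].
have [Sle|Slt] := leP S (e * #|V|%:R ^+ 2).
  exists C, c; split; last by left; exists (C * D)%type, (fun v => (c v, d v)).
  apply: leq_trans CK _; rewrite -[leqLHS]muln1 leq_mul //.
  by rewrite big_ord_recl addn_gt0 expn_gt0.
exists (C * D)%type, (fun v => (c v, d v)); split.
  rewrite card_prod leq_mul //; apply: leq_trans Dk _.
  have CK' : (#|C| < K.+1)%N by rewrite ltnS.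
  by rewrite (bigD1 (Ordinal CK')) //= leq_addr.
right; rewrite -addn1 natrD mulrDl mul1r.
have {}Slt := ltW Slt; rewrite SE in Slt.
by apply: le_trans (lerD le Slt) _; rewrite addrC subrK.
Qed.

(* The number of classes of [d] is irrelevant: what matters is that [g] is close to
   [stepw g d] at a precision that depends on the number of classes of [c]. *)
Lemma strong_regularity (e : R) (f : nat -> R) : 0 < e -> (forall j, 0 < f j) ->
  exists K : nat, forall (V : finType) (g : V -> V -> R),
    (0 < #|V|)%N -> (forall x y, unit_itv (g x y)) ->
  exists (C : finType) (c : V -> C) (D : finType) (d : V -> D),
   [/\ (#|C| <= K)%N,
      cut_le (fun x y => g x y - stepw g d x y) (f #|C| * #|V|%:R ^+ 2) &
      \sum_x \sum_y (stepw g d x y - stepw g c x y) ^+ 2 <= e * #|V|%:R ^+ 2].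
Proof.
move=> e0 f0; have [K KP] := strong_regularity_step (nsteps e) e0 f0.
exists K => V g V0 gU; have n0 : 0 < (#|V|%:R : R) by rewrite ltr0n.
have [C [c [CK [[D [d [cut le]]]|le]]]] := KP V g V0 gU.
  by exists C, c, D, d.
have := le_trans le (sten_le _ gU).
by rewrite mulrA -[leRHS]mul1r ler_pM2r ?exprn_gt0 // leNgt nsteps_gt1.
Qed.

Lemma stepw_sym (V : finType) (g : V -> V -> R) (C : finType) (c : V -> C) x y :
  (forall x y, g x y = g y x) -> stepw g c x y = stepw g c y x.
Proof.
move=> gS; rewrite /stepw /condexp; congr (_ / _).
  rewrite (reindex_inj (h := fun q : V * V => (q.2, q.1))); last by move=> [? ?] [? ?] [-> ->].
  by apply: eq_big => [[u v]|[u v] _] /=; rewrite ?[g v u]gS // /pairmap /= !xpair_eqE andbC.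
rewrite -!sum1_card; congr (_%:R).
rewrite (reindex_inj (h := fun q : V * V => (q.2, q.1))); last by move=> [? ?] [? ?] [-> ->].
by apply: eq_bigl => -[u v]; rewrite !inE /pairmap /= !xpair_eqE andbC.
Qed.

Lemma stepw_class (V : finType) (g : V -> V -> R) (C : finType) (c : V -> C) x y x' y' :
  c x = c x' -> c y = c y' -> stepw g c x y = stepw g c x' y'.
Proof. by move=> e1 e2; apply: condexp_class; rewrite /pairmap /= e1 e2. Qed.

End Regularity.

(** * Rigidity of the symmetrised density *)

Section Rigidity.
Variables (R : realType) (I : finType) (F : sgraph I) (p : R).
Hypotheses (p_gt0 : 0 < p) (eF : (0 < num_edges F)%N).

Lemma epair_exists : exists e, epair F e.
Proof.
by move: eF; rewrite -card_epair => /card_gt0P[e]; rewrite inE; exists e.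
Qed.

Lemma perm_to (u v i j : I) : u != v -> i != j -> exists s : {perm I}, s u = i /\ s v = j.
Proof.
move=> uv ij; exists (tperm u i * tperm (tperm u i v) j)%g.
rewrite !permM tpermL [tperm (tperm u i v) j (tperm u i v)]tpermL; split => //.
rewrite tpermD //; last by rewrite eq_sym.
by rewrite -{2}(tpermL u i) (inj_eq perm_inj) eq_sym.
Qed.

Lemma epair_neq e : epair F e -> e.1 != e.2.
Proof. by case/andP => + _; apply: contraTneq => ->; rewrite adj_irr. Qed.

Lemma hprod_eq_of_hsym (w : I -> I -> R) (s : {perm I}) :
  (forall s : {perm I}, hprod F w s <= p ^+ num_edges F) \/
  (forall s : {perm I}, p ^+ num_edges F <= hprod F w s) ->
  hsym F w id = p ^+ num_edges F -> hprod F w s = p ^+ num_edges F.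
Proof.
set c := p ^+ _ => H.
have f0 : (factorial #|I|)%:R != 0 :> R by rewrite pnatr_eq0 -lt0n fact_gt0.
move=> /(congr1 (fun z => (factorial #|I|)%:R * z)).
rewrite /hsym mulVKf // -card_permT mulr_natl -sumr_const => /eqP.
rewrite -subr_eq0 -sumrB.
case: H => H.
- rewrite -oppr_eq0 -sumrN psumr_eq0; last by move=> t _; rewrite opprB subr_ge0; exact: H.
  by move=> /allP/(_ s (mem_index_enum _)) /=; rewrite oppr_eq0 subr_eq0 => /eqP.
- rewrite psumr_eq0; last by move=> t _; rewrite subr_ge0; exact: H.
  by move=> /allP/(_ s (mem_index_enum _)) /=; rewrite subr_eq0 => /eqP.
Qed.

(* All terms of the average are on the same side of [p ^+ num_edges F], hence they
   are all equal to it. *)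
Lemma hsym_rigid (w : I -> I -> R) :
  (forall i j, i != j -> 0 <= w i j <= p) \/ (forall i j, i != j -> p <= w i j) ->
  hsym F w id = p ^+ num_edges F -> forall i j, i != j -> w i j = p.
Proof.
move=> H hw i j ij.
have [e ee] := epair_exists.
have [s [s1 s2]] := perm_to (epair_neq ee) ij.
have c0 (Q : pred (I * I)) : 0 < \prod_(e' | Q e') p by apply: prodr_gt0.
have pE : p ^+ num_edges F = \prod_(e | epair F e) p by rewrite prodr_const card_epair.
have ne (t : {perm I}) e' : epair F e' -> t e'.1 != t e'.2.
  by move=> /epair_neq; rewrite (inj_eq perm_inj).
pose Q e' := epair F e' && (e' != e).
(* The factors other than [w i j] are compared with [p] on the same side as [w i j] itself. This
   bounds [w i j] from the opposite side, and only powers of [p], which are positive, are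
   cancelled. *)
have E : hprod F w s = p ^+ num_edges F ->
    w i j * \prod_(e' | Q e') w (s e'.1) (s e'.2) = p * \prod_(e' | Q e') p.
  by rewrite pE /hprod (bigD1 e) //= s1 s2 => ->; rewrite [LHS](bigD1 e).
case: H => H.
  have {}E := E (hprod_eq_of_hsym s (or_introl _) hw).
  have /andP[w0 wp] := H _ _ ij; apply/eqP; rewrite eq_le wp /=.
  rewrite -(ler_pM2r (c0 Q)) -E; last first.
    by move=> t; rewrite pE; apply: ler_prod => e' ee'; exact: H (ne t _ ee').
  by rewrite ler_wpM2l //; apply: ler_prod => e' /andP[ee' _]; exact: H (ne s _ ee').
have {}E := E (hprod_eq_of_hsym s (or_intror _) hw).
apply/eqP; rewrite eq_le (H _ _ ij) andbT -(ler_pM2r (c0 Q)) -E; last first.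
  by move=> t; rewrite pE; apply: ler_prod => e' ee'; rewrite (ltW p_gt0) H ?ne.
rewrite ler_wpM2l ?(le_trans (ltW p_gt0) (H _ _ ij)) //.
by apply: ler_prod => e' /andP[ee' _]; rewrite (ltW p_gt0) H ?ne.
Qed.

End Rigidity.

(** * Limits along an ultrafilter *)

Section UltraLimits.
Local Open Scope classical_set_scope.
Local Open Scope ring_scope.
Variables (R : realType) (U : set_system nat).
Context {UU : UltraFilter U}.

(** By compactness of [0, 1] the image ultrafilter has a cluster point, which for an ultrafilter is
    a limit. One ultrafilter thus serves all rows of a matrix at once, with no extraction of
    subsequences. *)
Lemma ultra_lim (u : nat -> R) : (forall k, unit_itv (u k)) ->
  exists l, unit_itv l /\ u k @[k --> U] --> l.
Proof.
move=> uU.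
have uI : U (u @^-1` `[0, 1]).
  by apply: filterS filterT => k _ /=; rewrite in_itv /=; exact: uU.
have [l [l01 lc]] := @segment_compact R 0 1 (u @ U) _ uI.
exists l; split; first by move: l01; rewrite /= in_itv /=.
move=> A nA; have [//|nU] := in_ultra_setVsetC (u @^-1` A) UU.
have [z [nz Az]] := lc (~` A) A nU nA.
by [].
Qed.

Lemma cvg_sum_fin (T : finType) (Q : pred T) (f : T -> nat -> R) (l : T -> R) :
  (forall i, Q i -> f i k @[k --> U] --> l i) ->
  \sum_(i | Q i) f i k @[k --> U] --> \sum_(i | Q i) l i.
Proof.
move=> H; elim: (index_enum T) => [|i r IH].
  by under eq_cvg do rewrite big_nil; rewrite big_nil; exact: cvg_cst.
under eq_cvg do rewrite big_cons; rewrite big_cons; case: ifP => // Qi.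
by apply: cvgD => //; exact: H.
Qed.

Lemma cvg_prod_fin (T : finType) (Q : pred T) (f : T -> nat -> R) (l : T -> R) :
  (forall i, Q i -> f i k @[k --> U] --> l i) ->
  \prod_(i | Q i) f i k @[k --> U] --> \prod_(i | Q i) l i.
Proof.
move=> H; elim: (index_enum T) => [|i r IH].
  by under eq_cvg do rewrite big_nil; rewrite big_nil; exact: cvg_cst.
under eq_cvg do rewrite big_cons; rewrite big_cons; case: ifP => // Qi.
by apply: cvgM => //; exact: H.
Qed.

Lemma cvg_hsym (I : finType) (F : sgraph I) (w : nat -> I -> I -> R) (l : I -> I -> R) :
  (forall i j, i != j -> w k i j @[k --> U] --> l i j) ->
  hsym F (w k) id @[k --> U] --> hsym F l id.
Proof.
move=> H; apply: cvgM; first exact: cvg_cst.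
apply: cvg_sum_fin => s _; apply: cvg_prod_fin => e /epair_neq ne.
by apply: H; rewrite (inj_eq perm_inj).
Qed.

Lemma cvg_eventually_eq (u : nat -> R) (a b : R) :
  u k @[k --> U] --> a -> (\forall k \near U, u k = b) -> a = b.
Proof.
move=> ua ub.
have ub' : u k @[k --> U] --> b by exact: (@cvg_near_cst _ _ b u U _ ub).
exact: (norm_cvg_unique ua ub').
Qed.

End UltraLimits.

(** * Rigidity of infinite matrices and of finite samples *)

Section Sampling.
Local Open Scope classical_set_scope.
Local Open Scope ring_scope.
Variables (R : realType) (I : finType) (F : sgraph I) (p : R).
Hypotheses (p_gt0 : 0 < p) (p_le1 : p <= 1) (eF : (0 < num_edges F)%N).

Section Slots.
Variables (w : nat -> nat -> R) (a : nat -> R) (c : R).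
(* Indices of rank at least [k] are sent to infinity along the ultrafilter, the last
   one first: [a] is the limit of the rows of [w] and [c] the limit of [a]. *)
Definition slot (k : nat) (t : I -> nat) (i j : I) : R :=
  match (enum_rank i < k)%N, (enum_rank j < k)%N with
  | true, true => w (t i) (t j)
  | true, false => a (t i)
  | false, true => a (t j)
  | false, false => c
  end.
End Slots.

Lemma hsym_ext (T T' : Type) (w : T -> T -> R) (w' : T' -> T' -> R) (x : I -> T) (x' : I -> T') :
  (forall i j, w (x i) (x j) = w' (x' i) (x' j)) -> hsym F w x = hsym F w' x'.
Proof.
by move=> H; congr (_ * _); apply: eq_bigr => s _; apply: eq_bigr => e _; exact: H.
Qed.

Lemma rigid_nat (w : nat -> nat -> R) :
  (forall i j, unit_itv (w i j)) -> (forall i j, w i j = w j i) ->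
  (forall t : I -> nat, injective t -> hsym F w t = p ^+ num_edges F) ->
  w 0 1 = p.
Proof.
move=> wU wS wF.
have [U [UU Uoo]] := ultraFilterLemma (F := \oo) _.
have lim1 i : exists l, unit_itv l /\ w i k @[k --> U] --> l by exact: ultra_lim.
have {lim1}[a aP] := choice lim1.
have [c [cU cP]] := ultra_lim (fun i => (aP i).1).
(* Downward induction on the number of finite slots, rewritten as [#|I| - k]. The last finite slot
   receives an index [s] tending to infinity: eventually [s] differs from every [t i], and in the
   limit [w (t i) s] becomes [a (t i)] and [a s] becomes [c]. *)
have slotP k (t : I -> nat) : (k <= #|I|)%N ->
    (forall i j, (enum_rank i < k)%N -> (enum_rank j < k)%N -> t i = t j -> i = j) ->
    hsym F (slot w a c k t) id = p ^+ num_edges F.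
  move=> kI; rewrite -(subKn kI); move: (#|I| - k)%N (leq_subr k #|I|) => {k kI} k.
  elim: k t => [|k IH] t kI tI.
    rewrite -(wF t); first by apply: hsym_ext => i j; rewrite /slot subn0 !ltn_ord.
    by move=> i j; apply: tI; rewrite subn0 ltn_ord.
  have lt0 : (#|I| - k.+1 < #|I|)%N by rewrite ltn_subrL (leq_trans _ kI).
  pose i0 := enum_val (Ordinal lt0).
  have ri0 : enum_rank i0 = (#|I| - k.+1)%N :> nat by rewrite enum_valK.
  have skE : (#|I| - k = (#|I| - k.+1).+1)%N by rewrite -subSn.
  pose ts s i := if i == i0 then s else t i.
  have rlt i : (enum_rank i < #|I| - k)%N = (i == i0) || (enum_rank i < #|I| - k.+1)%N.
    rewrite skE ltnS leq_eqVlt -ri0; congr (_ || _).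
    by rewrite -(inj_eq enum_rank_inj).
  have rn : (enum_rank i0 < #|I| - k.+1)%N = false by rewrite ri0 ltnn.
  apply: (@cvg_eventually_eq R U _ (fun s => hsym F (slot w a c (#|I| - k) (ts s)) id)).
    apply: cvg_hsym => i j ij; rewrite /slot !rlt /ts.
    have [ei|ni] := eqVneq i i0; have [ej|nj] := eqVneq j i0; rewrite /= ?ei ?ej ?rn.
    - by rewrite ei ej eqxx in ij.
    - case: (enum_rank j < _)%N => //=; under eq_cvg do rewrite wS; exact: (aP _).2.
    - case: (enum_rank i < _)%N => //=; exact: (aP _).2.
    - by case: (enum_rank i < _)%N; case: (enum_rank j < _)%N; exact: cvg_cst.
  apply: Uoo; near=> s; apply: IH; first exact: ltnW.
  have ns i : t i != s.
    rewrite neq_ltn; apply/orP; left.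
    apply: (@leq_ltn_trans (\max_i t i)); first exact: leq_bigmax.
    by near: s; exact: nbhs_infty_gt.
  move=> i j; rewrite !rlt /ts.
  have [->|ni] := eqVneq i i0; have [->|nj] := eqVneq j i0 => //= ri rj.
  - by move=> e; have := ns j; rewrite e eqxx.
  - by move=> e; have := ns i; rewrite e eqxx.
  - exact: tI.
have [e ee] := epair_exists eF.
have e12 := epair_neq ee.
have I2 : (1 < #|I|)%N.
  rewrite -cardsT; apply: leq_trans (_ : #|[set e.1; e.2]%SET| <= _)%N.
    by rewrite cards2 e12.
  by apply: subset_leq_card; apply/fintype.subsetP => x _; rewrite inE.
pose i0 := enum_val (Ordinal (ltnW I2)).
pose i1 := enum_val (Ordinal I2).
have i01 : i0 != i1 by rewrite (inj_eq enum_val_inj).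
have r0 : enum_rank i0 = 0%N :> nat by rewrite enum_valK.
have r1 : enum_rank i1 = 1%N :> nat by rewrite enum_valK.
have rig := hsym_rigid p_gt0 eF.
(* With no finite slot all off-diagonal entries are [c], with one they are [a x] or [c], with two
   they are [w 0 1] or values already known. Each time a single unknown value is compared with [p],
   so all entries lie on one side, as [hsym_rigid] requires. *)
have cp : c = p.
  have S0 := @slotP 0 (fun=> 0%N) isT (fun i j => _).
  have := rig _ _ (S0 _) i0 i1 i01; rewrite /slot /=; apply => //.
  have /andP[c0 _] := cU.
  by case: (leP c p) => [le|/ltW le]; [left|right] => i j _; rewrite ?c0.
have ap x : a x = p.
  have S1 := @slotP 1 (fun=> x) (ltnW I2).
  have := rig _ _ (S1 _) i0 i1 i01; rewrite /slot r0 r1 /=; apply => //.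
    have /andP[a0 _] := (aP x).1.
    case: (leP (a x) p) => [le|/ltW le]; [left|right] => i j ij.
      case ri: (enum_rank i < 1)%N; case rj: (enum_rank j < 1)%N; rewrite ?cp ?a0 ?le ?lexx ?(ltW p_gt0) //.
      move: ri rj; rewrite !ltnS !leqn0 => /eqP ri /eqP rj; move: ij.
      by rewrite -(inj_eq enum_rank_inj) -val_eqE /= ri rj.
    case ri: (enum_rank i < 1)%N; case rj: (enum_rank j < 1)%N; rewrite ?cp ?a0 ?le ?lexx ?(ltW p_gt0) //.
    move: ri rj; rewrite !ltnS !leqn0 => /eqP ri /eqP rj; move: ij.
    by rewrite -(inj_eq enum_rank_inj) -val_eqE /= ri rj.
  move=> i j; rewrite !ltnS !leqn0 => /eqP ri /eqP rj _.
  by apply/enum_rank_inj/val_inj; rewrite /= ri rj.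
have S2 := @slotP 2 (fun i => enum_rank i) I2.
have := rig _ _ (S2 _) i0 i1 i01; rewrite /slot r0 r1 /=; apply; last first.
  by move=> i j _ _ /val_inj/enum_rank_inj.
have /andP[w0 _] := wU 0%N 1%N.
have w2 i j : i != j -> (enum_rank i < 2)%N -> (enum_rank j < 2)%N ->
    w (enum_rank i) (enum_rank j) = w 0%N 1%N.
  rewrite -(inj_eq enum_rank_inj) -val_eqE /=.
  by case: (val _) => [|[|?]] //; case: (val _) => [|[|?]].
case: (leP (w 0%N 1%N) p) => [le|/ltW le]; [left|right] => i j ij.
  case ri: (enum_rank i < 2)%N; case rj: (enum_rank j < 2)%N; rewrite ?ap ?cp ?w2 ?w0 ?le ?lexx ?(ltW p_gt0) //.
case ri: (enum_rank i < 2)%N; case rj: (enum_rank j < 2)%N; rewrite ?ap ?cp ?w2 ?w0 ?le ?lexx ?(ltW p_gt0) //.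
Unshelve. all: end_near.
Qed.

Local Notation gam := (p ^+ num_edges F).

(** Compactness: counterexamples [w k] for every [k] have an entrywise ultralimit, to which
    [rigid_nat] applies. The same [k] is sample size and penalty factor: the sample grows until it
    contains any given tuple, while the penalty forces the density on that tuple to its limit
    value. *)
Lemma sampling (eta : R) : 0 < eta -> exists (k : nat), forall w : nat -> nat -> R,
  (forall i j, unit_itv (w i j)) -> (forall i j, w i j = w j i) ->
  `|w 0%N 1%N - p| <= eta + k.+1%:R *
    \sum_(t : {ffun I -> 'I_k.+2} | injectiveb t) `|hsym F w (fun i => t i : nat) - gam|.
Proof.
move=> eta0; apply: contrapT => /forallNP H.
have {}H k : exists w : nat -> nat -> R,
  [/\ forall i j, unit_itv (w i j), forall i j, w i j = w j i &
    eta + k.+1%:R * \sum_(t : {ffun I -> 'I_k.+2} | injectiveb t)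
       `|hsym F w (fun i => t i : nat) - gam| < `|w 0%N 1%N - p|].
  have /existsNP[w /not_implyP[wU /not_implyP[wS /negP]]] := H k.
  by rewrite -ltNge; exists w.
have {H}[w wP] := choice H.
have [U [UU Uoo]] := ultraFilterLemma (F := \oo) _.
have lim2 ij : exists l, unit_itv l /\ w k ij.1 ij.2 @[k --> U] --> l.
  by apply: ultra_lim => k; have [] := wP k.
have {lim2}[l lP] := choice lim2.
pose w' i j := l (i, j).
have w'c i j : w k i j @[k --> U] --> w' i j := (lP (i, j)).2.
have le1 k : `|w k 0%N 1%N - p| <= 1.
  have [/(_ 0%N 1%N)/andP[w0 w1] _ _] := wP k.
  by rewrite ler_norml; apply/andP; split; move: (p_gt0) (p_le1) w0 w1; lra.
have w'p : w' 0%N 1%N = p.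
  apply: rigid_nat.
  - by move=> i j; exact: (lP (i, j)).1.
  - move=> i j; have ji : w k i j @[k --> U] --> w' j i.
      rewrite (_ : (fun k => w k i j) = (fun k => w k j i)); first exact: w'c.
      by apply/funext => k; have [_ + _] := wP k; apply.
    exact: (norm_cvg_unique (w'c i j) ji).
  - move=> t tI.
    have c1 : hsym F (w k) t @[k --> U] --> hsym F w' t.
      have := @cvg_hsym R U _ I F (fun k i j => w k (t i) (t j)) (fun i j => w' (t i) (t j)).
      by apply=> i j _; exact: w'c.
    have c2 : `|hsym F (w k) t - gam| @[k --> U] --> `|hsym F w' t - gam|.
      by apply: cvg_norm; apply: cvgB => //; exact: cvg_cst.
    apply/eqP; rewrite -subr_eq0 -normr_le0; apply/ler_addgt0Pl => d d0; rewrite addr0.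
    apply: (cvgr_to_le c2); apply: Uoo; near=> k.
    have kd : d^-1 < k.+1%:R.
      near: k; exists (Num.truncn d^-1) => // k /= dk.
      apply: lt_le_trans (truncnS_gt _) _.
      by rewrite ler_nat ltnS.
    have tk i : (t i < k.+2)%N.
      apply: (@leq_ltn_trans (\max_i t i)); first exact: leq_bigmax.
      by apply: ltnW; rewrite !ltnS; near: k; exact: nbhs_infty_ge.
    have [_ _ ltk] := wP k.
    pose t' : {ffun I -> 'I_k.+2} := [ffun i => Ordinal (tk i)].
    have t'I : injectiveb t'.
      by apply/injectiveP => i j; rewrite !ffunE => -[]; exact: tI.
    (* The penalised sum is at most 1, so the term of [t'] alone is below [k.+1%:R^-1], hence below
       [d]. *)
    have := lt_le_trans ltk (le1 k).
    rewrite (bigD1 t') //= (_ : hsym F (w k) (fun i => t' i : nat) = hsym F (w k) t); last first.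
      by apply: hsym_ext => i j; rewrite !ffunE.
    set X := `|_|; set Y := \sum_(_ | _) _ => lt1.
    have Y0 : 0 <= Y by apply: sumr_ge0.
    have X0 : 0 <= X by exact: normr_ge0.
    have k0 : 0 < (k.+1%:R : R) by rewrite ltr0n.
    have kX : k.+1%:R * X < 1.
      have kY : 0 <= k.+1%:R * Y by rewrite mulr_ge0 // ltW.
      by move: lt1 kY eta0; rewrite mulrDr; lra.
    have : X < k.+1%:R^-1 by rewrite -[ltRHS]mul1r ltr_pdivlMr // mulrC.
    move=> /ltW/le_trans; apply.
    by rewrite -[leRHS]invrK lef_pV2 ?posrE ?invr_gt0 // ltW.
have c3 : `|w k 0%N 1%N - p| @[k --> U] --> `|w' 0%N 1%N - p|.
  by apply: cvg_norm; apply: cvgB => //; exact: cvg_cst.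
have : eta <= `|w' 0%N 1%N - p|.
  apply: (cvgr_to_ge c3); apply: filterS filterT => k _.
  have [_ _ /ltW ltk] := wP k; apply: le_trans ltk.
  by rewrite lerDl mulr_ge0 // sumr_ge0.
by rewrite w'p subrr normr0 leNgt eta0.
Unshelve. all: end_near.
Qed.

Lemma sum_two_coords (V : finType) (J : finType) (i j : J) (h : V -> V -> R) : i != j ->
  #|V|%:R ^+ 2 * \sum_(x : {ffun J -> V}) h (x i) (x j) =
  #|V|%:R ^+ #|J| * \sum_x \sum_y h x y.
Proof.
move=> ij; rewrite expr2 -mulrA -(sum_update j) -(sum_update i) -sum_ffun1 mulr_suml.
apply: eq_bigr => x _; rewrite mul1r; apply: eq_bigr => y _; apply: eq_bigr => z _.
by rewrite !ffunE !eqxx (negPf ij).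
Qed.

(** [sampling] is applied to the matrix induced by a tuple [z] of k + 2 vertices and averaged over
    all [z]: the entry (0, 1) becomes a uniform pair of vertices, and by [sum_marginal] every
    injective [t] selects a uniform tuple on [I]. *)
Lemma rigid_average (eta : R) : 0 < eta -> exists C : R, 0 <= C /\
  forall (V : finType) (w : V -> V -> R), (0 < #|V|)%N ->
  (forall x y, unit_itv (w x y)) -> (forall x y, w x y = w y x) ->
  #|V|%:R ^+ #|I| * \sum_x \sum_y `|w x y - p| <=
   #|V|%:R ^+ 2 * (eta * #|V|%:R ^+ #|I| + C * \sum_(x : {ffun I -> V}) `|hsym F w x - gam|).
Proof.
move=> eta0; have [k kP] := sampling eta0.
pose T := #|[pred t : {ffun I -> 'I_k.+2} | injectiveb t]|.
exists (k.+1%:R * T%:R); split; first by rewrite mulr_ge0.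
move=> V w V0 wU wS; have n0 : 0 < (#|V|%:R : R) by rewrite ltr0n.
set n : R := #|V|%:R; set m := #|I|; set L := \sum_(x : {ffun I -> V}) _.
pose i0 : 'I_k.+2 := ord0; pose i1 : 'I_k.+2 := inord 1.
have i01 : i0 != i1 by rewrite -val_eqE /= inordK.
have le1 (z : {ffun 'I_k.+2 -> V}) : `|w (z i0) (z i1) - p| <= eta + k.+1%:R *
   \sum_(t : {ffun I -> 'I_k.+2} | injectiveb t) `|hsym F w [ffun i => z (t i)] - gam|.
  (* [inord] sends the indices beyond the sample to 0; range and symmetry survive, and the sum
     involves only indices below k + 2. *)
  have := kP (fun i j => w (z (inord i)) (z (inord j))) (fun i j => wU _ _) (fun i j => wS _ _).
  rewrite (_ : inord 0 = i0); last by apply/val_inj; rewrite /= inordK.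
  rewrite (eq_bigr (fun t : {ffun I -> 'I_k.+2} => `|hsym F w [ffun i => z (t i)] - gam|)) //.
  by move=> t _; congr (`|_ - _|); apply: hsym_ext => i j; rewrite !ffunE !inord_val.
rewrite -(@ler_pM2l _ (n ^+ k.+2)) ?exprn_gt0 //.
have E1 : n ^+ k.+2 * (n ^+ m * \sum_x \sum_y `|w x y - p|) =
   n ^+ m * n ^+ 2 * \sum_(z : {ffun 'I_k.+2 -> V}) `|w (z i0) (z i1) - p|.
  have := sum_two_coords (fun x y => `|w x y - p|) i01; rewrite card_ord -/n => E.
  by rewrite -mulrA E; ring.
rewrite E1.
apply: le_trans (ler_wpM2l _ (ler_sum _ (fun z _ => le1 z))) _.
  by rewrite mulr_ge0 // exprn_ge0 // ltW.
rewrite big_split /= -mulr_sumr sumr_const card_ffun card_ord -[eta *+ _]mulr_natr natrX -/n.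
rewrite exchange_big /=.
have E2 : n ^+ m * \sum_(t : {ffun I -> 'I_k.+2} | injectiveb t)
    \sum_(z : {ffun 'I_k.+2 -> V}) `|hsym F w [ffun i => z (t i)] - gam| = T%:R * (n ^+ k.+2 * L).
  rewrite mulr_sumr (eq_bigr (fun=> n ^+ k.+2 * L)); last first.
    move=> t /injectiveP tI.
    by have := @sum_marginal R V _ _ t (fun x => `|hsym F w x - gam|) tI; rewrite card_ord.
  by rewrite sumr_const -[LHS]mulr_natl.
rewrite mulrDr.
set S := \sum_(t | _) _ in E2 *.
rewrite [X in _ + X](_ : _ = n ^+ 2 * k.+1%:R * (n ^+ m * S)); last by ring.
by rewrite E2 le_eqVlt; apply/orP; left; apply/eqP; ring.
Qed.

End Sampling.

Section HsymSums.
Variables (R : realType) (I : finType) (F : sgraph I) (V : finType).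

Lemma sum_hsym (w : V -> V -> R) (a : I -> V -> R) :
  \sum_(x : {ffun I -> V}) hsym F w x * \prod_i a i (x i) =
  (factorial #|I|)%:R^-1 * \sum_(s : {perm I}) \sum_(y : {ffun I -> V})
      hprod F w y * \prod_i a (s i) (y i).
Proof.
rewrite (eq_bigr (fun x : {ffun I -> V} => (factorial #|I|)%:R^-1 *
   \sum_(s : {perm I}) hprod F w (fun i => x (s i)) * \prod_i a i (x i))); last first.
  by move=> x _; rewrite -mulrA mulr_suml.
rewrite -mulr_sumr exchange_big /=; congr (_ * _); apply: eq_bigr => s _.
rewrite [RHS](reindex (fun x : {ffun I -> V} => [ffun i => x (s i)] : {ffun I -> V})) /=; last first.
  exists (fun y : {ffun I -> V} => [ffun i => y ((s^-1)%g i)] : {ffun I -> V}) => y _;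
    by apply/ffunP => i; rewrite !ffunE ?permK ?permKV.
apply: eq_bigr => x _; congr (_ * _).
  by apply: eq_bigr => e _; rewrite !ffunE.
by rewrite (reindex_inj (@perm_inj _ s)); apply: eq_bigr => i _; rewrite ffunE.
Qed.

Lemma counting_hsym (w1 w2 : V -> V -> R) (a : I -> V -> R) (d : R) :
  (0 < #|V|)%N ->
  (forall x y, unit_itv (w1 x y)) -> (forall x y, unit_itv (w2 x y)) ->
  (forall k x, unit_itv (a k x)) ->
  cut_le (fun x y => w1 x y - w2 x y) (d * #|V|%:R ^+ 2) ->
  `|\sum_(x : {ffun I -> V}) (hsym F w1 x - hsym F w2 x) * \prod_k a k (x k)|
    <= (num_edges F)%:R * d * #|V|%:R ^+ #|I|.
Proof.
move=> V0 w1U w2U aU cut.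
under eq_bigr => x _ do rewrite mulrBl.
rewrite sumrB !sum_hsym -mulrBr -sumrB -[X in `|X|]subr0; apply: perm_average_le => s.
rewrite subr0 -sumrB; under eq_bigr => y _ do rewrite -mulrBl.
exact: (counting F V0 w1U w2U (fun k => aU (s k)) cut).
Qed.

Lemma prod_diff_le (T : finType) (Q : pred T) (f g : T -> R) :
  (forall i, unit_itv (f i)) -> (forall i, unit_itv (g i)) ->
  `|\prod_(i | Q i) f i - \prod_(i | Q i) g i| <= \sum_(i | Q i) `|f i - g i|.
Proof.
move=> fU gU; elim: (index_enum T) => [|i r IH].
  by rewrite !big_nil subrr normr0.
rewrite !big_cons; case: ifP => // _.
set A := \prod_(_ <- _ | _) f _; set B := \prod_(_ <- _ | _) g _.
have -> : f i * A - g i * B = (f i - g i) * B + f i * (A - B) by ring.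
apply: le_trans (ler_normD _ _) _; apply: lerD.
  rewrite normrM ler_piMr // ger0_norm; first by apply: prodr_ile1 => j _; exact: gU.
  by apply: prodr_ge0 => j _; have /andP[] := gU j.
rewrite normrM; apply: le_trans IH; rewrite ler_piMl //.
by have /andP[f0 f1] := fU i; rewrite ger0_norm.
Qed.

Lemma hsym_L1 (w1 w2 : V -> V -> R) :
  (forall x y, unit_itv (w1 x y)) -> (forall x y, unit_itv (w2 x y)) ->
  #|V|%:R ^+ 2 * \sum_(x : {ffun I -> V}) `|hsym F w1 x - hsym F w2 x| <=
  #|V|%:R ^+ #|I| * ((num_edges F)%:R * \sum_x \sum_y `|w1 x y - w2 x y|).
Proof.
move=> w1U w2U; set Z := \sum_x \sum_y _.
have f0 : 0 < ((factorial #|I|)%:R : R) by rewrite ltr0n fact_gt0.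
apply: (@le_trans _ _ (#|V|%:R ^+ 2 * ((factorial #|I|)%:R^-1 * \sum_(s : {perm I})
   \sum_(e | epair F e) \sum_(x : {ffun I -> V})
     `|w1 (x (s e.1)) (x (s e.2)) - w2 (x (s e.1)) (x (s e.2))|))).
  rewrite ler_wpM2l ?exprn_ge0 ?ler0n //.
  under [X in _ <= _ * X]eq_bigr => s _ do rewrite exchange_big.
  rewrite exchange_big mulr_sumr; apply: ler_sum => x _.
  rewrite /hsym -mulrBr normrM gtr0_norm ?invr_gt0 // ler_wpM2l ?invr_ge0 ?(ltW f0) //.
  rewrite -sumrB; apply: le_trans (ler_norm_sum _ _ _) _; apply: ler_sum => s _.
  exact: prod_diff_le.
rewrite mulrCA mulrC ler_pdivrMr // mulr_sumr.
rewrite (eq_bigr (fun=> #|V|%:R ^+ #|I| * ((num_edges F)%:R * Z))).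
  by rewrite sumr_const card_permT -[leLHS]mulr_natr.
move=> s _; rewrite mulr_sumr (eq_bigr (fun=> #|V|%:R ^+ #|I| * Z)).
  by rewrite sumr_const card_epair -[LHS]mulr_natl mulrCA.
move=> e /epair_neq ne.
by rewrite (sum_two_coords (fun x y => `|w1 x y - w2 x y|)) // (inj_eq perm_inj).
Qed.

End HsymSums.

(** * From the symmetrised density to the cut norm *)

Section CutOfHsym.
Variables (R : realType) (I : finType) (F : sgraph I) (p : R).
Hypotheses (p_gt0 : 0 < p) (p_le1 : p <= 1) (eF : (0 < num_edges F)%N).
Local Notation gam := (p ^+ num_edges F).

Definition hsym_disc (V : finType) (g : V -> V -> R) (d : R) :=
  forall a : I -> V -> R, (forall k x, unit_itv (a k x)) ->
  `|\sum_(x : {ffun I -> V}) (hsym F g x - gam) * \prod_i a i (x i)| <= d * #|V|%:R ^+ #|I|.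

Lemma sum_norm_const (T : finType) (Q : pred T) (f : T -> R) :
  (forall x y, Q x -> Q y -> f x = f y) ->
  \sum_(x | Q x) `|f x| = `|\sum_(x | Q x) f x|.
Proof.
move=> H; case: (pickP Q) => [x0 Q0|Q0]; last by rewrite !big_pred0 // normr0.
rewrite (eq_bigr (fun=> `|f x0|)); last by move=> x Qx; rewrite (H x x0).
rewrite [in RHS](eq_bigr (fun=> f x0)); last by move=> x Qx; rewrite (H x x0).
by rewrite !sumr_const normrMn.
Qed.

(** Tuples are grouped by the classes of their entries. On each of the |C|^|I| boxes
    [hsym F (stepw g c)] is constant, so the absolute value leaves the sum, and the box is a product
    of indicators, to which [disc] and the counting lemma apply. The L^1 distance of the two step
    functions is paid once over all boxes. *)
Lemma hsym_step_L1 (V C D : finType) (g : V -> V -> R) (c : V -> C) (d : V -> D) (f t de : R) :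
  (0 < #|V|)%N -> (forall x y, unit_itv (g x y)) ->
  cut_le (fun x y => g x y - stepw g d x y) (f * #|V|%:R ^+ 2) ->
  \sum_x \sum_y `|stepw g d x y - stepw g c x y| <= t * #|V|%:R ^+ 2 ->
  hsym_disc g de ->
  \sum_(x : {ffun I -> V}) `|hsym F (stepw g c) x - gam| <=
   (#|C|%:R ^+ #|I| * (de + (num_edges F)%:R * f) + (num_edges F)%:R * t) * #|V|%:R ^+ #|I|.
Proof.
move=> V0 gU cut tle disc; have n0 : 0 < (#|V|%:R : R) by rewrite ltr0n.
set wd := stepw g d; set wc := stepw g c.
pose cx (x : {ffun I -> V}) : {ffun I -> C} := [ffun i => c (x i)].
pose ind (k : {ffun I -> C}) (i : I) (v : V) : R := (c v == k i)%:R.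
have indU k i v : unit_itv (ind k i v) by rewrite /unit_itv /ind ler0n lern1; case: eqP.
have sumI (k : {ffun I -> C}) (phi : {ffun I -> V} -> R) : \sum_(x | cx x == k) phi x =
    \sum_(x : {ffun I -> V}) phi x * \prod_i ind k i (x i).
  rewrite big_mkcond /=; apply: eq_bigr => x _.
  have -> : \prod_i ind k i (x i) = (cx x == k)%:R.
    rewrite /ind prod_bool; congr (_%:R); congr nat_of_bool.
    apply/forallP/eqP => [H|<- i]; last by rewrite ffunE eqxx.
    by apply/ffunP => i; rewrite ffunE; apply/eqP; have := H i.
  by case: ifP; rewrite ?mulr1 ?mulr0.
rewrite (partition_big cx xpredT) //=.
have stepk k : \sum_(x | cx x == k) `|hsym F wc x - gam| <=
   de * #|V|%:R ^+ #|I| + (num_edges F)%:R * f * #|V|%:R ^+ #|I| +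
   \sum_(x | cx x == k) `|hsym F wd x - hsym F wc x|.
  rewrite sum_norm_const; last first.
    move=> x y /eqP kx /eqP ky; congr (_ - _); apply: hsym_ext => i j.
    by apply: stepw_class; move: kx; rewrite -ky => /ffunP H; [have := H i|have := H j]; rewrite !ffunE.
  rewrite (eq_bigr (fun x : {ffun I -> V} => (hsym F g x - gam) - (hsym F g x - hsym F wd x)
      - (hsym F wd x - hsym F wc x))); last first.
    by move=> x _; move: (hsym F g x) (hsym F wd x) (hsym F wc x) (gam) => ? ? ? ?; ring.
  rewrite sumrB; apply: le_trans (ler_normB _ _) _; apply: lerD; last exact: ler_norm_sum.
  rewrite sumrB; apply: le_trans (ler_normB _ _) _; apply: lerD; rewrite sumI; first exact: disc.
  by apply: counting_hsym => // x y; exact: stepw_unit.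
apply: le_trans (ler_sum _ (fun k _ => stepk k)) _.
rewrite big_split /= sumr_const.
have <- : \sum_(x : {ffun I -> V}) `|hsym F wd x - hsym F wc x| =
    \sum_k \sum_(x | cx x == k) `|hsym F wd x - hsym F wc x|.
  by rewrite (partition_big cx xpredT).
rewrite mulrDl; apply: lerD.
  by rewrite card_ffun -[leLHS]mulr_natl natrX -mulrDl mulrA.
rewrite -(ler_pM2l (exprn_gt0 2 n0)).
have wcU x y : unit_itv (wc x y) by exact: stepw_unit.
have wdU x y : unit_itv (wd x y) by exact: stepw_unit.
apply: le_trans (hsym_L1 F wdU wcU) _.
rewrite [leRHS](_ : _ = #|V|%:R ^+ #|I| * ((num_edges F)%:R * (t * #|V|%:R ^+ 2))); last by ring.
by rewrite !ler_wpM2l ?exprn_ge0 ?ler0n.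
Qed.

(** The difference [g - p] is split at [stepw g d] and [stepw g c]: the first piece is small in cut
    norm, the second in L^1 by Cauchy-Schwarz, the third in L^1 by [hsym_step_L1] and
    [rigid_average]. *)
Lemma cut_of_hsym (eta : R) : 0 < eta -> exists2 de : R, 0 < de &
  forall (V : finType) (g : V -> V -> R), (0 < #|V|)%N ->
  (forall x y, unit_itv (g x y)) -> (forall x y, g x y = g y x) ->
  hsym_disc g de -> cut_le (fun x y => g x y - p) (eta * #|V|%:R ^+ 2).
Proof.
move=> eta0; have e40 : 0 < eta / 4 by rewrite divr_gt0.
have [C [C0 CP]] := rigid_average p_gt0 p_le1 eF e40.
pose e : R := (num_edges F)%:R.
have e0 : 0 <= e by exact: ler0n.
pose B := 1 + C * e + C.
have B0 : 0 < B by rewrite /B ltr_wpDr // ltr_wpDr // mulr_ge0.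
pose th := eta / 4 / B.
have th0 : 0 < th by rewrite divr_gt0.
(* The last divisor beats the number of boxes for [j] classes and [B] the constants of
   [rigid_average], so that the total error splits into four quarters of [eta]. *)
pose f (j : nat) := eta / 4 / B / (j%:R ^+ #|I| + 1).
have j0 (j : nat) : 0 < j%:R ^+ #|I| + 1 :> R by rewrite ltr_wpDl ?exprn_ge0 ?ler0n.
have f0 j : 0 < f j by rewrite divr_gt0 // divr_gt0.
have th20 : 0 < th ^+ 2 by rewrite exprn_gt0.
have [K KP] := strong_regularity th20 f0.
(* The tolerance is fixed before the partition, so [f] is taken at the bound [K] on its number of
   classes. *)
exists (f K); first exact: f0.
move=> V g V0 gU gS disc; have n0 : 0 < (#|V|%:R : R) by rewrite ltr0n.
have [Cl [c [D [d [CK cut L2]]]]] := KP V g V0 gU.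
set n : R := #|V|%:R in n0 cut L2 *.
have L1 : \sum_x \sum_y `|stepw g d x y - stepw g c x y| <= th * n ^+ 2.
  have th_n : 0 <= th * n ^+ 2 by rewrite mulr_ge0 ?(ltW th0) ?exprn_ge0 ?(ltW n0).
  rewrite -(@ler_pXn2r _ 2) ?nnegrE //; last by apply: sumr_ge0 => x _; exact: sumr_ge0.
  rewrite pair_big /=.
  apply: le_trans (sqr_sum_le (mem (predT : {pred V * V})) _) _.
  rewrite card_prod natrM -/n [leRHS](_ : _ = n * n * (th ^+ 2 * n ^+ 2)); last by ring.
  rewrite ler_wpM2l ?mulr_ge0 ?(ltW n0) //; apply: le_trans L2.
  by rewrite pair_big /=; apply: ler_sum => q _; rewrite real_normK ?num_real.
have wU x y : unit_itv (stepw g c x y) by exact: stepw_unit.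
have wS x y : stepw g c x y = stepw g c y x by exact: stepw_sym.
have := CP V _ V0 wU wS; rewrite -/n.
have := hsym_step_L1 V0 gU cut L1 disc; rewrite -/n -/e.
set L := \sum_(x : {ffun I -> V}) _; set X := \sum_x \sum_y _.
set k : R := #|Cl|%:R ^+ #|I| => Lle Xle.
have k0 : 0 <= k by rewrite exprn_ge0 ?ler0n.
have {Lle}Xle : X <= n ^+ 2 * (eta / 4 + C * (k * (f K + e * f #|Cl|) + e * th)).
  rewrite -(ler_pM2l (exprn_gt0 #|I| n0)); apply: le_trans Xle _.
  rewrite [leRHS](_ : _ = n ^+ 2 * (eta / 4 * n ^+ #|I| +
     C * ((k * (f K + e * f #|Cl|) + e * th) * n ^+ #|I|))); last by ring.
  by rewrite ler_wpM2l ?exprn_ge0 ?(ltW n0) // lerD2l ler_wpM2l.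
move=> S T.
have -> : \sum_(x in S) \sum_(y in T) (g x y - p) =
    \sum_(x in S) \sum_(y in T) (g x y - stepw g d x y) +
    \sum_(x in S) \sum_(y in T) (stepw g d x y - stepw g c x y) +
    \sum_(x in S) \sum_(y in T) (stepw g c x y - p).
  rewrite -!big_split /=; apply: eq_bigr => x _; rewrite -!big_split /=.
  by apply: eq_bigr => y _; ring.
have L1ST (h : V -> V -> R) : `|\sum_(x in S) \sum_(y in T) h x y| <= \sum_x \sum_y `|h x y|.
  apply: le_trans (ler_norm_sum _ _ _) _; rewrite big_mkcond; apply: ler_sum => x _.
  case: ifP => _; last exact: sumr_ge0.
  apply: le_trans (ler_norm_sum _ _ _) _; rewrite big_mkcond; apply: ler_sum => y _.
  by case: ifP.
apply: le_trans (ler_normD _ _) _; apply: le_trans (lerD (ler_normD _ _) (lexx _)) _.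
apply: le_trans (lerD (lerD (cut S T) (le_trans (L1ST _) L1)) (le_trans (L1ST _) Xle)) _.
rewrite [n ^+ 2 * _]mulrC -!mulrDl ler_wpM2r ?exprn_ge0 ?(ltW n0) //.
have b1 : th + C * (e * th) <= eta / 4.
  rewrite (_ : eta / 4 = th * B); last by rewrite /th divfK // gt_eqF.
  by rewrite /B !mulrDr mulr1 [th * (C * e)]mulrC -mulrA lerDl mulr_ge0 // ltW.
have fE j : f j * B * (j%:R ^+ #|I| + 1) = eta / 4.
  by rewrite /f mulrAC divfK ?gt_eqF // divfK // gt_eqF.
have b2 : f #|Cl| + C * (k * (e * f #|Cl|)) <= eta / 4.
  rewrite -(fE #|Cl|) -/k; set z := f _; have z0 : 0 < z by exact: f0.
  rewrite -subr_ge0.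
  have -> : z * B * (k + 1) - (z + C * (k * (e * z))) =
     z * (C * e + C + k + C * k) by rewrite /B; ring.
  by rewrite mulr_ge0 ?(ltW z0) // !addr_ge0 // mulr_ge0.
have b3 : C * (k * f K) <= eta / 4.
  rewrite -(fE K); set z := f _; have z0 : 0 < z by exact: f0.
  have kK : k <= K%:R ^+ #|I| by rewrite lerXn2r ?nnegrE ?ler0n // ler_nat.
  set kk := _ ^+ _ in kK *; have kk0 : 0 <= kk by exact: le_trans kK.
  apply: (@le_trans _ _ (C * (kk * z))).
    by rewrite ler_wpM2l // ler_wpM2r // ltW.
  rewrite -subr_ge0.
  have -> : z * B * (kk + 1) - C * (kk * z) = z * (1 + C * e + C + kk + C * e * kk).
    by rewrite /B; ring.
  by rewrite mulr_ge0 ?(ltW z0) // !addr_ge0 // !mulr_ge0.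
rewrite [leLHS](_ : _ = (f #|Cl| + C * (k * (e * f #|Cl|))) + (th + C * (e * th))
  + C * (k * f K) + eta / 4); last by ring.
rewrite [leRHS](_ : _ = eta / 4 + eta / 4 + eta / 4 + eta / 4); last by field.
by rewrite lerD2r !lerD.
Qed.

End CutOfHsym.

(** * From sets of prescribed sizes to weights *)

Section RandomColouring.
Variables (R : realType) (V I : finType) (u : I -> V -> R).
Hypotheses (u_ge0 : forall i v, 0 <= u i v) (u_sum : forall v, \sum_i u i v <= 1).

(* A vertex of colour [None] belongs to none of the sets. *)
Definition cprob (v : V) (o : option I) : R :=
  if o is Some i then u i v else 1 - \sum_i u i v.

Definition cweight (c : {ffun V -> option I}) : R := \prod_v cprob v (c v).

Lemma big_option (g : option I -> R) : \sum_o g o = g None + \sum_i g (Some i).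
Proof.
rewrite (bigD1 None) //=; congr (_ + _).
rewrite (reindex_omap Some id) /=; last by case.
by apply: eq_bigl => i; rewrite eqxx.
Qed.

Lemma cprob_sum v : \sum_o cprob v o = 1.
Proof. by rewrite big_option /= subrK. Qed.

Lemma cprob_ge0 v o : 0 <= cprob v o.
Proof. by case: o => [i|] //=; rewrite subr_ge0. Qed.

Lemma cweight_ge0 c : 0 <= cweight c.
Proof. by apply: prodr_ge0 => v _; exact: cprob_ge0. Qed.

Lemma cweight_cyl (D : {set V}) (k : V -> option I) :
  \sum_c cweight c * \prod_(v in D) (c v == k v)%:R = \prod_(v in D) cprob v (k v).
Proof.
pose g v o : R := cprob v o * (if v \in D then (o == k v)%:R else 1).
rewrite (eq_bigr (fun c : {ffun V -> option I} => \prod_v g v (c v))); last first.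
  by move=> c _; rewrite big_split /=; congr (_ * _); rewrite big_mkcond.
rewrite -bigA_distr_bigA [RHS]big_mkcond /=; apply: eq_bigr => v _; rewrite /g.
case: ifP => _; last by rewrite -[RHS](cprob_sum v); apply: eq_bigr => o _; rewrite mulr1.
rewrite (bigD1 (k v)) //= eqxx mulr1 big1 ?addr0 // => o /negPf ->.
by rewrite mulr0.
Qed.

Lemma cweight_sum : \sum_c cweight c = 1.
Proof.
have := cweight_cyl finset.set0 (fun=> None); rewrite big_set0 => <-.
by apply: eq_bigr => c _; rewrite big_set0 mulr1.
Qed.

Definition msum (f : {ffun I -> V} -> R) (a : I -> V -> R) : R :=
  \sum_(x : {ffun I -> V}) f x * \prod_i a i (x i).

Definition cind (c : {ffun V -> option I}) (i : I) (v : V) : R := (c v == Some i)%:R.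

(* Colours of distinct vertices are independent, but a non-injective [x] would use
   one vertex twice. *)
Lemma msum_expect (f : {ffun I -> V} -> R) :
  (forall x : {ffun I -> V}, ~~ injectiveb x -> f x = 0) ->
  msum f u = \sum_c cweight c * msum f (cind c).
Proof.
move=> f0; rewrite /msum.
under [RHS]eq_bigr => c _ do rewrite mulr_sumr.
rewrite exchange_big /=; apply: eq_bigr => x _.
have [/injectiveP xI|/f0 ->] := boolP (injectiveb x); last first.
  by rewrite mul0r big1 // => c _; rewrite mul0r mulr0.
under [RHS]eq_bigr => c _ do rewrite mulrCA.
rewrite -mulr_sumr; congr (_ * _).
pose k v := [pick i | x i == v].
have kx i : k (x i) = Some i.
  by rewrite /k; case: pickP => [j /eqP/xI -> //|/(_ i)]; rewrite eqxx.
have := cweight_cyl (x @: I) k; rewrite big_imset /=; last by move=> i j _ _; exact: xI.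
move=> E; rewrite (eq_bigr (fun i => cprob (x i) (k (x i)))); last by move=> i _; rewrite kx.
rewrite (eq_bigl (mem I)) // -E; apply: eq_bigr => c _; congr (_ * _).
rewrite big_imset /=; last by move=> i j _ _; exact: xI.
by apply: eq_big => // i _; rewrite /cind kx.
Qed.

Lemma cind_first i v : \sum_c cweight c * cind c i v = u i v.
Proof.
have := cweight_cyl [set v]%SET (fun=> Some i); rewrite big_set1 /= => <-.
by apply: eq_bigr => c _; rewrite big_set1.
Qed.

Lemma cind_second i v v' :
  \sum_c cweight c * (cind c i v * cind c i v') <= u i v * u i v' + (v == v')%:R.
Proof.
have [<-|vv] := eqVneq v v'.
  apply: (@le_trans _ _ 1); last by rewrite lerDr mulr_ge0.
  rewrite -[leRHS]cweight_sum; apply: ler_sum => c _.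
  rewrite ler_piMr ?cweight_ge0 // /cind; case: eqP => _; by rewrite ?mulr1 ?mulr0 ?ler01.
have := cweight_cyl [set v; v']%SET (fun=> Some i).
rewrite big_setU1 ?inE //= big_set1 /= addr0 => <-.
by apply: ler_sum => c _; rewrite big_setU1 ?inE //= big_set1.
Qed.

(** Distinct vertices are uncorrelated, so only the diagonal contributes, with at most 1 per
    vertex. *)
Lemma colour_variance i :
  \sum_c cweight c * (\sum_v cind c i v - \sum_v u i v) ^+ 2 <= #|V|%:R.
Proof.
set mu := \sum_v u i v.
have E1 : \sum_c cweight c * \sum_v cind c i v = mu.
  under eq_bigr => c _ do rewrite mulr_sumr.
  by rewrite exchange_big /=; apply: eq_bigr => v _; exact: cind_first.
have E2 : \sum_c cweight c * (\sum_v cind c i v) ^+ 2 <= mu ^+ 2 + #|V|%:R.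
  apply: (@le_trans _ _ (\sum_v \sum_v' (u i v * u i v' + (v == v')%:R))).
    rewrite (eq_bigr (fun c => \sum_v \sum_v' cweight c * (cind c i v * cind c i v'))); last first.
      move=> c _; rewrite expr2 mulr_suml mulr_sumr; apply: eq_bigr => v _.
      by rewrite !mulr_sumr.
    rewrite exchange_big /=; apply: ler_sum => v _; rewrite exchange_big /=.
    by apply: ler_sum => v' _; exact: cind_second.
  under eq_bigr => v _ do rewrite big_split /= -mulr_sumr.
  rewrite big_split /= -mulr_suml -expr2 lerD2l -sum1_card natr_sum; apply: ler_sum => v _.
  rewrite (bigD1 v) //= eqxx big1 ?addr0 // => v' /negPf; rewrite eq_sym => ->.
  by [].
rewrite (eq_bigr (fun c => cweight c * (\sum_v cind c i v) ^+ 2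
   - 2 * mu * (cweight c * \sum_v cind c i v) + mu ^+ 2 * cweight c)); last first.
  by move=> c _; ring.
rewrite big_split /= sumrB -!mulr_sumr E1 cweight_sum; move: E2; set z := \sum_c _.
by rewrite mulr1 => E2; rewrite -mulrA -expr2; lra.
Qed.

(** Chebyshev in the form |z| <= l n + z^2 / (l n), which avoids square roots; with variance at most
    n the second term is at most 1 / l. *)
Lemma colour_deviation i (l : R) : 0 < l -> (0 < #|V|)%N ->
  \sum_c cweight c * `|\sum_v cind c i v - \sum_v u i v| <= l * #|V|%:R + l^-1.
Proof.
move=> l0 V0; have n0 : 0 < (#|V|%:R : R) by rewrite ltr0n.
have ln0 : 0 < l * #|V|%:R by rewrite mulr_gt0.
have amgm (z : R) : `|z| <= l * #|V|%:R + (l * #|V|%:R)^-1 * z ^+ 2.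
  have [le|/ltW le] := leP `|z| (l * #|V|%:R).
    by apply: le_trans le _; rewrite lerDl mulr_ge0 ?sqr_ge0 // invr_ge0 ltW.
  apply: (@le_trans _ _ ((l * #|V|%:R)^-1 * z ^+ 2)); last by rewrite lerDr ltW.
  rewrite -(real_normK (num_real z)) mulrC ler_pdivlMr // expr2 ler_wpM2l //.
apply: (@le_trans _ _ (\sum_c (l * #|V|%:R * cweight c + (l * #|V|%:R)^-1 *
   (cweight c * (\sum_v cind c i v - \sum_v u i v) ^+ 2)))).
  apply: ler_sum => c _; apply: le_trans (ler_wpM2l (cweight_ge0 c) (amgm _)) _.
  by rewrite mulrDr [X in X + _ <= _]mulrC [X in _ + X <= _]mulrCA.
rewrite big_split /= -!mulr_sumr cweight_sum mulr1 lerD2l.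
apply: le_trans (ler_wpM2l _ (colour_variance i)) _; first by rewrite invr_ge0 ltW.
by rewrite invfM mulfVK // gt_eqF.
Qed.

End RandomColouring.

(** * Correcting a colouring to exact class sizes *)

Section FixSizes.
Variables (R : realType) (V I : finType) (f : {ffun I -> V} -> R) (k : I -> nat).
Hypotheses (f_le1 : forall x, `|f x| <= 1) (k_sum : (\sum_i k i <= #|V|)%N).

Definition csize (c : {ffun V -> option I}) i := #|[pred v | c v == Some i]|.

Definition cdist (c : {ffun V -> option I}) : nat :=
  \sum_i ((csize c i - k i) + (k i - csize c i)).

(** Only the tuples through [v0] are affected: at most |I| n^(|I| - 1) of them, each by at most
    1. *)
Lemma msum_recolour (c : {ffun V -> option I}) (v0 : V) (o : option I) :
  #|V|%:R * `|msum f (cind R c) - msum f (cind R (upd c v0 o))| <= #|I|%:R * #|V|%:R ^+ #|I|.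
Proof.
apply: (@le_trans _ _ (#|V|%:R * \sum_(x : {ffun I -> V}) \sum_i (x i == v0)%:R)).
  rewrite ler_wpM2l ?ler0n // /msum -sumrB; apply: le_trans (ler_norm_sum _ _ _) _.
  apply: ler_sum => x _; rewrite -mulrBr normrM.
  case: (boolP [exists i, x i == v0]) => [/existsP[i xi]|/existsPn nx].
    apply: (@le_trans _ _ 1); last first.
      by rewrite (bigD1 i) //= xi lerDl; apply: sumr_ge0 => *; exact: ler0n.
    rewrite mulr_ile1 // /cind !prod_bool.
    by case: [forall _, _]; case: [forall _, _]; rewrite ?subrr ?normr0 ?subr0 ?sub0r ?normrN ?normr1.
  rewrite [X in _ - X](_ : _ = \prod_i cind R c i (x i)).
    by rewrite subrr normr0 mulr0; apply: sumr_ge0 => *; exact: ler0n.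
  by apply: eq_bigr => i _; rewrite /cind ffunE (negPf (nx i)).
rewrite exchange_big mulr_sumr (eq_bigr (fun=> #|V|%:R ^+ #|I|)).
  by rewrite sumr_const -[leLHS]mulr_natl.
move=> i _; rewrite -(sum_update i) -sum_ffun1; apply: eq_bigr => x _.
rewrite (bigD1 v0) //= ffunE eqxx eqxx big1 ?addr0 // => y /negPf yv.
by rewrite ffunE eqxx yv.
Qed.

Lemma csize_upd c v0 o i : csize (upd c v0 o) i =
  (csize c i - (c v0 == Some i) + (o == Some i))%N.
Proof.
rewrite /csize (cardD1 v0) [in RHS](cardD1 v0) !inE ffunE eqxx addKn addnC; congr (_ + _)%N.
by apply: eq_card => v; rewrite !inE ffunE; case: eqP.
Qed.

(** A vertex of an oversized class loses its colour. If no class is oversized but one is too small,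
    [k_sum] leaves an uncoloured vertex, which is given to that class. *)
Lemma recolour_closer c : (0 < cdist c)%N -> exists v0 o, (cdist (upd c v0 o) < cdist c)%N.
Proof.
move=> d0.
have upd_lt v0 o j : (forall i, i != j -> csize (upd c v0 o) i = csize c i) ->
  ((csize (upd c v0 o) j - k j) + (k j - csize (upd c v0 o) j) <
   (csize c j - k j) + (k j - csize c j))%N -> (cdist (upd c v0 o) < cdist c)%N.
  move=> eqi ltj; rewrite /cdist (bigD1 j) //= [in ltnRHS](bigD1 j) //=.
  by rewrite -addSn leq_add // leq_sum // => i ij; rewrite eqi.
case: (boolP [exists i, k i < csize c i]%N) => [/existsP[i ki]|/existsPn ck].
  have [v0] : exists v, v \in [pred v | c v == Some i].
    by apply/card_gt0P; exact: leq_ltn_trans ki.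
  rewrite inE => /eqP cv; exists v0, None; apply: (@upd_lt _ _ i) => [j ji|].
    by rewrite csize_upd cv /= (inj_eq Some_inj) eq_sym (negPf ji) subn0 addn0.
  by rewrite csize_upd cv eqxx /=; lia.
have [i ki] : exists i, (csize c i < k i)%N.
  apply/existsP; apply: contraTT d0 => /existsPn kc; rewrite -leqNgt leqn0 /cdist sum_nat_eq0.
  by apply/forallP => i; have := ck i; have := kc i; lia.
have [v0 cv] : exists v, c v = None.
  apply: contrapT => /forallNP cN.
  have : (#|V| <= \sum_i csize c i)%N.
    rewrite -sum1_card (partition_big c (fun o => o != None)) /=; last by move=> v _; exact/eqP.
    rewrite (reindex_omap Some id) /=; last by case.
    rewrite leq_eqVlt; apply/orP; left; apply/eqP; apply: eq_big => [j|j _]; first by rewrite eqxx.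
    by rewrite sum1_card; apply: eq_card => v; rewrite !inE.
  rewrite leqNgt => /negP; apply; apply: leq_trans k_sum.
  rewrite (bigD1 i) //= [in ltnRHS](bigD1 i) //= -addSn leq_add // leq_sum // => j _.
  by rewrite leqNgt ck.
exists v0, (Some i); apply: (@upd_lt _ _ i) => [j ji|].
  by rewrite csize_upd cv /= (inj_eq Some_inj) eq_sym (negPf ji) subn0 addn0.
by rewrite csize_upd cv eqxx /=; lia.
Qed.

Lemma colouring_with_sizes c : exists2 c', (forall i, csize c' i = k i) &
  #|V|%:R * `|msum f (cind R c) - msum f (cind R c')|
     <= (cdist c)%:R * (#|I|%:R * #|V|%:R ^+ #|I|).
Proof.
have [N] := ubnP (cdist c); elim: N c => // N IH c; rewrite ltnS => cN.
have [d0|d0] := posnP (cdist c).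
  exists c; last by rewrite d0 subrr normr0 mulr0 mul0r.
  move=> i; move/eqP: d0; rewrite sum_nat_eq0 => /forallP/(_ i) /=; lia.
have [v0 [o lt]] := recolour_closer d0.
have [c' c'k c'le] := IH _ (leq_trans lt cN).
exists c' => //.
set A := msum f (cind R c); set B := msum f (cind R (upd c v0 o)) in c'le *; set D := msum f _ in c'le *.
have -> : A - D = (A - B) + (B - D) by ring.
apply: le_trans (ler_wpM2l _ (ler_normD _ _)) _; first exact: ler0n.
rewrite mulrDr; apply: le_trans (lerD (msum_recolour c v0 o) c'le) _.
rewrite -{1}[#|I|%:R * _]mul1r -mulrDl ler_wpM2r ?mulr_ge0 ?exprn_ge0 ?ler0n //.
by rewrite nat1r ler_nat.
Qed.

End FixSizes.

Section Fractional.
Variables (R : realType) (V I : finType) (f : {ffun I -> V} -> R) (k : I -> nat).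
Hypotheses (f_le1 : forall x, `|f x| <= 1) (k_sum : (\sum_i k i <= #|V|)%N).
Hypothesis f_inj : forall x : {ffun I -> V}, ~~ injectiveb x -> f x = 0.
Variable e : R.
Hypothesis f_disc : forall U : I -> {set V},
  (forall i j, i != j -> [disjoint U i & U j]%B) -> (forall i, #|U i| = k i) ->
  `|msum f (fun i v => (v \in U i)%:R)| <= e * #|V|%:R ^+ #|I|.

(** The value at [u] is an expectation over random colourings. Each is corrected to the sizes [k] at
    a normalised cost |I| / n per recoloured vertex, and the expected number of these is at most |I|
    (1 + l n + 1 / l), where 1 bounds the distance from the mean to [k i]. *)
Lemma fractional (u : I -> V -> R) (l : R) :
  (0 < #|V|)%N -> 0 < l ->
  (forall i v, 0 <= u i v) -> (forall v, \sum_i u i v <= 1) ->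
  (forall i, `|\sum_v u i v - (k i)%:R| <= 1) ->
  `|msum f u| <= (e + #|I|%:R ^+ 2 * (l + (l^-1 + 1) / #|V|%:R)) * #|V|%:R ^+ #|I|.
Proof.
move=> V0 l0 u0 u1 uk; have n0 : 0 < (#|V|%:R : R) by rewrite ltr0n.
have fd := f_disc; set n : R := #|V|%:R in n0 fd *.
have one c : `|msum f (cind R c)| <= e * n ^+ #|I| +
    n^-1 * (#|I|%:R * n ^+ #|I|) * \sum_i (1 + `|\sum_v cind R c i v - \sum_v u i v|).
  have [c' c'k c'le] := @colouring_with_sizes R V I f k f_le1 k_sum c.
  have -> : msum f (cind R c) = msum f (cind R c') + (msum f (cind R c) - msum f (cind R c')) by ring.
  apply: le_trans (ler_normD _ _) _; apply: lerD.
    have := @fd (fun i => [set v | c' v == Some i]%SET).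
    rewrite (_ : msum f (fun i v => _) = msum f (cind R c')); last first.
      apply: eq_bigr => x _; congr (_ * _); apply: eq_bigr => i _; by rewrite inE.
    apply=> [i j ij|i]; last by rewrite cardsE; exact: c'k.
    apply/pred0P => v /=; rewrite !inE; apply/negP => /andP[/eqP -> /eqP[ji]].
    by rewrite ji eqxx in ij.
  rewrite -(ler_pM2l n0); apply: le_trans c'le _.
  rewrite [leRHS](_ : _ = (\sum_i (1 + `|\sum_v cind R c i v - \sum_v u i v|)) * (#|I|%:R * n ^+ #|I|)).
    rewrite ler_wpM2r ?mulr_ge0 ?exprn_ge0 ?ler0n // natr_sum; apply: ler_sum => i _.
    have -> : \sum_v cind R c i v = (csize c i)%:R.
      by rewrite /csize -sum1_card natr_sum [RHS]big_mkcond; apply: eq_bigr => v _; rewrite /cind inE; case: eqP.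
    apply: (@le_trans _ _ `|(csize c i)%:R - (k i)%:R|).
      rewrite natrD; case: (leqP (k i) (csize c i)) => [le|/ltnW le].
        by rewrite (eqP le) addr0 natrB // ler_norm.
      by rewrite (eqP le) add0r natrB // distrC ler_norm.
    rewrite (_ : _ - _ = (\sum_v u i v - (k i)%:R) + ((csize c i)%:R - \sum_v u i v)); last by ring.
    by apply: le_trans (ler_normD _ _) _; rewrite lerD2r.
  by rewrite !mulrA mulfV ?gt_eqF // mul1r mulrC mulrA.
rewrite (msum_expect u f_inj); apply: le_trans (ler_norm_sum _ _ _) _.
set A := e * _ in one; set B := _ * (_ * _) in one.
have B0 : 0 <= B by rewrite !mulr_ge0 ?invr_ge0 ?exprn_ge0 ?(ltW n0).
apply: (@le_trans _ _ (\sum_c (A * cweight u c + B * \sum_i (cweight u c +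
    cweight u c * `|\sum_v cind R c i v - \sum_v u i v|)))).
  apply: ler_sum => c _; rewrite normrM ger0_norm ?cweight_ge0 //.
  apply: le_trans (ler_wpM2l (cweight_ge0 u0 u1 c) (one c)) _.
  rewrite mulrDr [_ * A]mulrC lerD2l mulrCA ler_wpM2l // mulr_sumr.
  by apply: ler_sum => i _; rewrite mulrDr mulr1.
rewrite big_split /= -!mulr_sumr cweight_sum // mulr1 exchange_big /=.
rewrite mulrDl lerD2l.
apply: (@le_trans _ _ (B * \sum_(i : I) (1 + (l * n + l^-1)))).
  rewrite ler_wpM2l //; apply: ler_sum => i _; rewrite big_split /= cweight_sum // lerD2l.
  exact: colour_deviation.
rewrite sumr_const -[_ *+ _]mulr_natl /B le_eqVlt; apply/orP; left; apply/eqP.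
by field; rewrite gt_eqF //= gt_eqF.
Qed.

End Fractional.

(** * Freeing the coordinates *)

Section Multilinear.
Variables (R : realType) (V I : finType) (f : {ffun I -> V} -> R).

Definition setc (u : I -> V -> R) (i : I) (phi : V -> R) : I -> V -> R :=
  fun j => if j == i then phi else u j.

Lemma msum_setc_lin u i x y (phi psi : V -> R) :
  msum f (setc u i (fun v => x * phi v + y * psi v)) =
  x * msum f (setc u i phi) + y * msum f (setc u i psi).
Proof.
rewrite /msum !mulr_sumr -big_split /=; apply: eq_bigr => z _.
have E (h : V -> R) : \prod_j setc u i h j (z j) = h (z i) * \prod_(j | j != i) u j (z j).
  rewrite (bigD1 i) //= /setc eqxx; congr (_ * _).
  by apply: eq_bigr => j /negPf ->.
by rewrite !E; ring.
Qed.

Lemma setc_id u i : setc u i (u i) = u.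
Proof. by apply/funext => j; rewrite /setc; case: eqP => [->|]. Qed.

Variables (a b : I) (ab : a != b).
Hypothesis f_sym : forall x : {ffun I -> V}, f [ffun i => x (tperm a b i)] = f x.

Lemma msum_setc_sym u (phi psi : V -> R) :
  msum f (setc (setc u a phi) b psi) = msum f (setc (setc u a psi) b phi).
Proof.
rewrite /msum (reindex (fun x : {ffun I -> V} => [ffun i => x (tperm a b i)] : {ffun I -> V})) /=; last first.
  by exists (fun x : {ffun I -> V} => [ffun i => x (tperm a b i)] : {ffun I -> V}) => x _;
    apply/ffunP => i; rewrite !ffunE tpermK.
apply: eq_bigr => x _; rewrite f_sym; congr (_ * _).
rewrite (reindex_inj (@perm_inj _ (tperm a b))) /=; apply: eq_bigr => i _.
rewrite ffunE tpermK /setc; case: tpermP => [->|->|/eqP/negPf -> /eqP/negPf -> //].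
  by rewrite (negPf ab) !eqxx.
by rewrite (negPf ab) !eqxx.
Qed.

End Multilinear.

(** * Polarisation of a symmetric bilinear form *)

Section Polarise.
Variables (R : realType) (V : finType) (g : (V -> R) -> (V -> R) -> R).
Hypothesis V0 : (0 < #|V|)%N.
Hypothesis gL : forall x y phi phi' psi,
  g (fun v => x * phi v + y * phi' v) psi = x * g phi psi + y * g phi' psi.
Hypothesis gS : forall phi psi, g phi psi = g psi phi.
Variables (A B C t M : R) (rho : V -> R).
Hypotheses (A01 : 0 < A <= 1) (B01 : 0 < B <= 1) (AB : A != B) (C0 : 0 <= C) (t0 : 0 < t)
  (M0 : 0 < M).
Hypotheses (rho0 : \sum_v rho v = 0) (rhoM : forall v, `|rho v| <= M * t).
Hypothesis gC : forall s : V -> R, \sum_v s v = 0 -> (forall v, `|s v| <= t) ->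
  `|g (fun v => A - rho v / 2 + s v) (fun v => B - rho v / 2 - s v)| <= C.

Let one : V -> R := fun=> 1.

Lemma bilR x y phi psi psi' :
  g phi (fun v => x * psi v + y * psi' v) = x * g phi psi + y * g phi psi'.
Proof. by rewrite gS gL gS [g psi' _]gS. Qed.

Lemma bilZ x y phi psi : g (fun v => x * phi v) (fun v => y * psi v) = x * y * g phi psi.
Proof.
have -> : (fun v => x * phi v) = (fun v => x * phi v + 0 * phi v).
  by apply/funext => v; rewrite mul0r addr0.
have -> : (fun v => y * psi v) = (fun v => y * psi v + 0 * psi v).
  by apply/funext => v; rewrite mul0r addr0.
by rewrite gL bilR; ring.
Qed.

Lemma bil0 phi : g phi (fun=> 0) = 0.
Proof.
have -> : (fun=> 0 : R) = (fun v => 0 * one v + 0 * one v).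
  by apply/funext => v; rewrite mul0r addr0.
by rewrite bilR !mul0r addr0.
Qed.

Let D := `|B - A|.
Let D0 : 0 < D. Proof. by rewrite normr_gt0 subr_eq0 eq_sym. Qed.

Lemma polar_expand s : g (fun v => A - rho v / 2 + s v) (fun v => B - rho v / 2 - s v) =
  A * B * g one one - (A + B) / 2 * g one rho + (B - A) * g one s + g rho rho / 4 - g s s.
Proof.
have -> : (fun v => A - rho v / 2 + s v) =
    (fun v => 1 * (fun v => A * one v + (- 2^-1) * rho v) v + 1 * s v).
  by apply/funext => v; rewrite /one; ring.
have -> : (fun v => B - rho v / 2 - s v) =
    (fun v => 1 * (fun v => B * one v + (- 2^-1) * rho v) v + (-1) * s v).
  by apply/funext => v; rewrite /one; ring.
rewrite !gL !bilR.
by rewrite [g s one]gS [g s rho]gS [g rho one]gS; field.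
Qed.

Lemma bilN s : g one (fun v => - s v) = - g one s /\ g (fun v => - s v) (fun v => - s v) = g s s.
Proof.
have E : (fun v => - s v) = (fun v => -1 * s v) by apply/funext => v; rewrite mulN1r.
split; last by rewrite E bilZ; ring.
have -> : g one (fun v => - s v) = g (fun v => 1 * one v) (fun v => -1 * s v).
  by congr g; apply/funext => v; rewrite ?mul1r ?mulN1r.
by rewrite bilZ; ring.
Qed.

(** The values at [s] and [- s] differ by 2 (B - A) g(1, s), and their mean is the value at 0 minus
    g(s, s). *)
Lemma polar_small s : \sum_v s v = 0 -> (forall v, `|s v| <= t) ->
  `|g one s| <= C / D /\ `|g s s| <= 2 * C.
Proof.
move=> s0 st.
have zs : \sum_(v : V) (0 : R) = 0 by rewrite big1.
have zt (v : V) : `|0 : R| <= t by rewrite normr0 ltW.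
have Ns : \sum_v - s v = 0 by rewrite sumrN s0 oppr0.
have Nt v : `|- s v| <= t by rewrite normrN.
have [z1 z2] := (bil0 one, bil0 (fun=> 0)).
have [n1 n2] := bilN s.
have h1 := gC s0 st; have h2 := gC Ns Nt; have {zs zt}h3 := gC zs zt.
rewrite polar_expand in h1; rewrite polar_expand n1 n2 in h2; rewrite polar_expand z1 z2 in h3.
move: h1 h2 h3; set K := A * B * _ - _; set K' := g rho rho / 4.
set p := g one s; set q := g s s.
rewrite !ler_norml => /andP[h1 h1'] /andP[h2 h2'] /andP[h3 h3'].
split; last by apply/andP; split; lra.
rewrite -ler_norml ler_pdivlMr // /D -normrM ler_norml mulrC; apply/andP; split; lra.
Qed.

Lemma polar_scaled L phi : 0 < L -> \sum_v phi v = 0 -> (forall v, `|phi v| <= L * t) ->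
  `|g one phi| <= L * (C / D) /\ `|g phi phi| <= L ^+ 2 * (2 * C).
Proof.
move=> L0 p0 pt; pose s v := L^-1 * phi v.
have s0 : \sum_v s v = 0 by rewrite -mulr_sumr p0 mulr0.
have st v : `|s v| <= t.
  rewrite normrM gtr0_norm ?invr_gt0 // mulrC ler_pdivrMr // mulrC; exact: pt.
have [h1 h2] := polar_small s0 st.
have E : phi = (fun v => L * s v) by apply/funext => v; rewrite /s mulVKf // gt_eqF.
have E1 : g one phi = L * g one s.
  have := @bilZ 1 L one s; rewrite mul1r => <-.
  by rewrite {1}E; congr g; apply/funext => v; rewrite mul1r.
have E2 : g phi phi = L ^+ 2 * g s s by rewrite {1 2}E bilZ expr2.
have L2 : 0 <= L ^+ 2 by rewrite exprn_ge0 ?(ltW L0).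
rewrite E1 E2 normrM [`|L ^+ 2 * _|]normrM (ger0_norm (ltW L0)) (ger0_norm L2).
by split; rewrite ler_wpM2l ?(ltW L0).
Qed.

(** 4 g(phi, psi) is the difference of the quadratic form at phi + psi and at phi - psi, both
    bounded by 2 L t. *)
Lemma polar_pair L phi psi : 0 < L -> \sum_v phi v = 0 -> (forall v, `|phi v| <= L * t) ->
  \sum_v psi v = 0 -> (forall v, `|psi v| <= L * t) ->
  `|g phi psi| <= L ^+ 2 * (4 * C).
Proof.
move=> L0 p0 pt q0 qt; have L20 : 0 < 2 * L by rewrite mulr_gt0.
have s1 : \sum_v (1 * phi v + 1 * psi v) = 0 by rewrite big_split /= -!mulr_sumr p0 q0 !mulr0 addr0.
have s2 : \sum_v (1 * phi v + (-1) * psi v) = 0.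
  by rewrite big_split /= -!mulr_sumr p0 q0 !mulr0 addr0.
have t1 v : `|1 * phi v + 1 * psi v| <= 2 * L * t.
  by rewrite !mul1r; apply: le_trans (ler_normD _ _) _; move: (pt v) (qt v); lra.
have t2 v : `|1 * phi v + (-1) * psi v| <= 2 * L * t.
  by rewrite mul1r mulN1r; apply: le_trans (ler_normB _ _) _; move: (pt v) (qt v); lra.
have [_ h1] := polar_scaled L20 s1 t1; have [_ h2] := polar_scaled L20 s2 t2.
move: h1 h2; rewrite !gL !bilR [g psi phi]gS !ler_norml.
move: (g phi phi) (g phi psi) (g psi psi) => x y z /andP[h1 h1'] /andP[h2 h2'].
have E : (2 * L) ^+ 2 * (2 * C) = 2 * (L ^+ 2 * (4 * C)) by ring.
by rewrite E in h1 h1' h2 h2' *; apply/andP; split; lra.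
Qed.

(* The first term bounds [g 1 1], the second one [g 1 s] twice and the last one
   [g s s'], for centred [s] and [s'] with values in [-1, 1]. *)
Definition kpolar : R := (1 + M / D + M ^+ 2) / (A * B) + 2 / (t * D) + 4 / t ^+ 2.

(** At [s = 0] the hypothesis leaves A B g(1, 1) and terms in [rho]; as [rho] is centred,
    [polar_scaled] bounds these with L = M. *)
Lemma polar_one : `|g one one| <= (1 + M / D + M ^+ 2) / (A * B) * C.
Proof.
have /andP[A0 A1] := A01; have /andP[B0 B1] := B01.
have zs : \sum_(v : V) (0 : R) = 0 by rewrite big1.
have zt (v : V) : `|0 : R| <= t by rewrite normr0 ltW.
have [z1 z2] := (bil0 one, bil0 (fun=> 0)).
have := gC zs zt; rewrite polar_expand z1 z2 mulr0 subr0 addr0 => {zs zt}h.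
have [h1 h2] := polar_scaled M0 rho0 rhoM.
have AB0 : 0 < A * B by rewrite mulr_gt0.
suff : `|A * B * g one one| <= (1 + M / D + M ^+ 2) * C.
  by rewrite normrM (gtr0_norm AB0) => key; rewrite [leRHS]mulrAC ler_pdivlMr // [leLHS]mulrC.
rewrite [A * B * _](_ : _ = (A * B * g one one - (A + B) / 2 * g one rho + g rho rho / 4)
   + ((A + B) / 2 * g one rho - g rho rho / 4)); last by ring.
apply: le_trans (ler_normD _ _) _.
rewrite [leRHS](_ : _ = C + (M / D * C + M ^+ 2 * C)); last by ring.
apply: lerD => //.
apply: le_trans (ler_normB _ _) _; apply: lerD.
  rewrite normrM; apply: le_trans (_ : 1 * `|g one rho| <= _).
    rewrite ler_wpM2r // ger0_norm; last by rewrite divr_ge0 // addr_ge0 // ltW.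
    by rewrite ler_pdivrMr // mul1r; move: A1 B1; lra.
  by rewrite mul1r; apply: le_trans h1 _; rewrite -mulrA [D^-1 * C]mulrC.
rewrite normrM [`|4^-1|]gtr0_norm ?invr_gt0 // ler_pdivrMr //; apply: le_trans h2 _.
rewrite -[leRHS]mulrA ler_wpM2l ?exprn_ge0 ?(ltW M0) //.
by move: C0; lra.
Qed.

(** Each weight is its mean times [one] plus a centred part with values in [-1, 1], which is the
    scaled case with L = 1 / t. *)
Lemma polarise phi psi : (forall v, unit_itv (phi v)) -> (forall v, unit_itv (psi v)) ->
  `|g phi psi| <= kpolar * C.
Proof.
move=> pU qU; have n0 : 0 < (#|V|%:R : R) by rewrite ltr0n.
pose av (h : V -> R) := (\sum_v h v) / #|V|%:R.
have avU h : (forall v, unit_itv (h v)) -> unit_itv (av h).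
  move=> hU; rewrite /unit_itv divr_ge0 ?(ltW n0) ?sumr_ge0 //=; last first.
    by move=> v _; have /andP[] := hU v.
  rewrite ler_pdivrMr // mul1r -sum1_card natr_sum; apply: ler_sum => v _.
  by have /andP[] := hU v.
pose ce h v := h v - av h.
have ce0 h : \sum_v ce h v = 0.
  by rewrite /ce sumrB sumr_const -[av h *+ _]mulr_natr /av divfK ?subrr // gt_eqF.
have cet h : (forall v, unit_itv (h v)) -> forall v, `|ce h v| <= t^-1 * t.
  move=> hU v; rewrite mulVf ?gt_eqF // /ce.
  have /andP[x0 x1] := hU v; have /andP[y0 y1] := avU _ hU.
  by rewrite ler_norml; apply/andP; split; move: x0 x1 y0 y1; lra.
have E h : h = (fun v => av h * one v + 1 * ce h v).
  by apply/funext => v; rewrite /ce /one; ring.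
rewrite (E phi) (E psi) gL !bilR [g (ce phi) one]gS.
have ti0 : 0 < t^-1 by rewrite invr_gt0.
have [h1 _] := polar_scaled ti0 (ce0 phi) (cet _ pU).
have [h2 _] := polar_scaled ti0 (ce0 psi) (cet _ qU).
have h3 := polar_pair ti0 (ce0 phi) (cet _ pU) (ce0 psi) (cet _ qU).
have h4 := polar_one.
have /andP[x0 x1] := avU _ pU; have /andP[y0 y1] := avU _ qU.
rewrite !mulrDr !mul1r.
have mle (c z Z : R) : 0 <= c -> c <= 1 -> `|z| <= Z -> `|c * z| <= Z.
  move=> c0 c1 zZ; rewrite normrM ger0_norm //; apply: le_trans zZ.
  by rewrite ler_piMl.
have m1 := mle _ _ _ x0 x1 (mle _ _ _ y0 y1 h4).
have m2 := mle _ _ _ x0 x1 h2.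
have m3 := mle _ _ _ y0 y1 h1.
have -> : kpolar * C = (1 + M / D + M ^+ 2) / (A * B) * C + t^-1 * (C / D) +
   (t^-1 * (C / D) + t^-1 ^+ 2 * (4 * C)).
  rewrite /kpolar; move: (_ / (A * B)) => k; field.
  by rewrite !gt_eqF.
apply: le_trans (ler_normD _ _) _; apply: lerD.
  by apply: le_trans (ler_normD _ _) _; apply: lerD.
by apply: le_trans (ler_normD _ _) _; apply: lerD.
Qed.

End Polarise.

Section FreeCoordinates.
Variables (R : realType) (V I : finType) (f : {ffun I -> V} -> R) (alpha : I -> R).
Hypothesis V0 : (0 < #|V|)%N.
Variable t : R.
Hypotheses (t0 : 0 < t) (talpha : forall i, t <= alpha i).

Definition near_alpha (i : I) (phi : V -> R) :=
  (forall v, `|phi v - alpha i| <= t) /\ \sum_v phi v = alpha i * #|V|%:R.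

Definition free_bound (A : {set I}) (C : R) := forall u : I -> V -> R,
  (forall i, i \in A -> forall v, unit_itv (u i v)) ->
  (forall i, i \notin A -> near_alpha i (u i)) -> `|msum f u| <= C.

(* [u i] is a combination of [alpha i + t * (u i - mean)] and of [alpha i], which
   are both admissible. *)
Lemma free_step (A : {set I}) (C : R) (i : I) : i \notin A -> 0 <= C -> free_bound A C ->
  free_bound (i |: A)%SET (3 / t * C).
Proof.
move=> iA C0 H u uA uN; have n0 : 0 < (#|V|%:R : R) by rewrite ltr0n.
have uiU := uA i (setU11 _ _).
have ai0 : 0 < alpha i := lt_le_trans t0 (talpha i).
pose av := (\sum_v u i v) / #|V|%:R.
have /andP[av0 av1] : unit_itv av.
  rewrite /unit_itv divr_ge0 ?(ltW n0) ?sumr_ge0 //=; last first.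
    by move=> v _; have /andP[] := uiU v.
  rewrite ler_pdivrMr // mul1r -sum1_card natr_sum; apply: ler_sum => v _.
  by have /andP[] := uiU v.
pose phi1 v := alpha i + t * (u i v - av).
pose phi2 (v : V) := alpha i.
have N2 : near_alpha i phi2.
  split=> [v|]; first by rewrite subrr normr0 ltW.
  by rewrite sumr_const -[LHS]mulr_natr.
have N1 : near_alpha i phi1.
  split=> [v|].
    rewrite /phi1 addrC addKr normrM gtr0_norm // -[leRHS]mulr1 ler_wpM2l ?(ltW t0) //.
    have /andP[x0 x1] := uiU v.
    by rewrite ler_norml; apply/andP; split; move: x0 x1 av0 av1; lra.
  rewrite /phi1 big_split /= sumr_const -mulr_sumr sumrB sumr_const.
  rewrite -[alpha i *+ _]mulr_natr -[av *+ _]mulr_natr /av divfK ?gt_eqF //.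
  by rewrite subrr mulr0 addr0.
have HN phi : near_alpha i phi -> `|msum f (setc u i phi)| <= C.
  move=> Np; apply: H => j jA; rewrite /setc; case: eqP => [ji|/eqP ji].
  - by rewrite -ji jA in iA.
  - by apply: uA; rewrite !inE jA orbT.
  - by rewrite ji.
  - by apply: uN; rewrite !inE negb_or ji.
have h1 := HN _ N1; have h2 := HN _ N2.
have E : u i = (fun v => t^-1 * phi1 v + (av / alpha i - t^-1) * phi2 v).
  apply/funext => v; rewrite /phi1 /phi2; field.
  by rewrite !gt_eqF.
rewrite -(setc_id u i) E msum_setc_lin.
rewrite [X in `|X|](_ : _ = t^-1 * msum f (setc u i phi1) - t^-1 * msum f (setc u i phi2)
   + av / alpha i * msum f (setc u i phi2)); last by ring.
have ti : `|t^-1| = t^-1 by rewrite gtr0_norm ?invr_gt0.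
apply: le_trans (ler_normD _ _) _; apply: le_trans (lerD (ler_normB _ _) (lexx _)) _.
have -> : 3 / t * C = t^-1 * C + t^-1 * C + t^-1 * C by ring.
have avt : av / alpha i <= t^-1.
  rewrite ler_pdivrMr // mulrC ler_pdivlMr //; apply: le_trans (talpha i).
  by rewrite ler_piMl // ltW.
have m1 z : `|z| <= C -> `|t^-1 * z| <= t^-1 * C.
  by move=> zC; rewrite normrM ti ler_wpM2l // invr_ge0 ltW.
have m2 z : `|z| <= C -> `|av / alpha i * z| <= t^-1 * C.
  have av_ge0 := divr_ge0 av0 (ltW ai0).
  by move=> zC; rewrite normrM (ger0_norm av_ge0) ler_pM.
by rewrite !lerD ?m1 ?m2.
Qed.

Lemma free_all (A : {set I}) (C : R) : 0 <= C -> free_bound A C ->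
  free_bound [set: I]%SET ((3 / t) ^+ #|~: A|%SET * C).
Proof.
have [N] := ubnP #|~: A|%SET; elim: N A C => // N IH A C; rewrite ltnS => AN C0 H.
case: (pickP (mem (~: A)%SET)) => [i iA|A0]; last first.
  have AE : ~: A = finset.set0 by apply/setP => i; have := A0 i; rewrite !inE.
  rewrite AE cards0 expr0 mul1r.
  have -> : [set: I]%SET = A by rewrite -[A]finset.setCK AE finset.setC0.
  exact: H.
have {}iA : i \in (~: A)%SET by exact: iA.
have cA : #|~: A|%SET = (#|~: (i |: A)|%SET).+1.
  rewrite (cardsD1 i) iA add1n; congr (_.+1); apply: eq_card => j.
  by rewrite !inE negb_or.
have iA' : i \notin A by move: iA; rewrite inE.
rewrite cA exprSr -mulrA; apply: IH; first by rewrite -cA.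
  by rewrite mulr_ge0 // divr_ge0 // ltW.
exact: free_step.
Qed.

End FreeCoordinates.

Section FreeInit.
Variables (R : realType) (V I : finType) (f : {ffun I -> V} -> R) (alpha : I -> R).
Hypothesis V0 : (0 < #|V|)%N.
Hypotheses (alpha_gt0 : forall i, 0 < alpha i) (alpha_sum : \sum_i alpha i <= 1).
Variable C : R.
Hypothesis C0 : 0 <= C.
Hypothesis fC : forall u : I -> V -> R, (forall i v, 0 <= u i v) ->
  (forall v, \sum_i u i v <= 1) -> (forall i, \sum_v u i v = alpha i * #|V|%:R) ->
  `|msum f u| <= C.

(** The slack in the sum absorbs a deviation [t] in every coordinate at once. *)
Lemma free_init_lt (t : R) : (forall i, t <= alpha i) -> #|I|%:R * t <= 1 - \sum_i alpha i ->
  free_bound f alpha t finset.set0 C.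
Proof.
move=> ta It u _ uN.
have {}uN i : near_alpha alpha t i (u i) by apply: uN; rewrite inE.
apply: fC => [i v|v|i]; last exact: (uN i).2.
- by have := (uN i).1 v; rewrite ler_norml => /andP[h _]; move: h (ta i); lra.
- apply: (@le_trans _ _ (\sum_i (alpha i + t))).
    apply: ler_sum => i _; have := (uN i).1 v; rewrite ler_norml => /andP[_]; lra.
  by rewrite big_split /= sumr_const -[t *+ _]mulr_natl; move: It; lra.
Qed.

(** The function [rho] collects the deviations of the coordinates other than [a] and [b].
    Subtracting half of it from each of these two restores the bound on the sum, and mass [s] can
    still be moved between them; the margin (|I| + 1) t keeps the weights nonnegative. [polarise]
    then admits arbitrary weights at [a] and [b]. *)
Lemma free_init_sym (t : R) (a b : I) : 0 < t -> alpha a != alpha b ->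
  (forall x : {ffun I -> V}, f [ffun i => x (tperm a b i)] = f x) ->
  (forall i, (#|I|%:R + 1) * t <= alpha i) ->
  free_bound f alpha t [set a; b]%SET
     (kpolar (alpha a) (alpha b) t #|I|%:R * C).
Proof.
move=> t0 aab fS ta u uA uN.
have ab : a != b by apply: contraNneq aab => ->.
pose Q i := (i != a) && (i != b).
have QN i : Q i -> near_alpha alpha t i (u i).
  by move=> /andP[ia ib]; apply: uN; rewrite !inE negb_or ia.
pose rho v := \sum_(i | Q i) (u i v - alpha i).
have I0 : (0 < #|I|)%N by apply/card_gt0P; exists a.
have alpha_le1 i : 0 < alpha i <= 1.
  rewrite alpha_gt0 /=; apply: le_trans alpha_sum; rewrite (bigD1 i) //= lerDl.
  by apply: sumr_ge0 => j _; exact: ltW.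
have rho0 : \sum_v rho v = 0.
  rewrite exchange_big /= big1 // => i Qi; rewrite sumrB (QN i Qi).2 sumr_const.
  by rewrite -[alpha i *+ _]mulr_natr subrr.
have rhoM v : `|rho v| <= #|I|%:R * t.
  apply: le_trans (ler_norm_sum _ _ _) _.
  apply: (@le_trans _ _ (\sum_(i : I) t)); last by rewrite sumr_const -[leLHS]mulr_natl.
  by rewrite big_mkcond /=; apply: ler_sum => i _; case: ifP => [/QN[h _]|_]; rewrite ?h ?ltW.
pose g phi psi := msum f (setc (setc u a phi) b psi).
have gS phi psi : g phi psi = g psi phi by exact: msum_setc_sym.
have gL x y phi phi' psi :
    g (fun v => x * phi v + y * phi' v) psi = x * g phi psi + y * g phi' psi.
  by rewrite gS /g msum_setc_lin -!/(g _ _) gS [g psi phi']gS.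
have -> : msum f u = g (u a) (u b) by rewrite /g !setc_id.
have M0 : 0 < #|I|%:R :> R by rewrite ltr0n.
apply: (@polarise R V g V0 gL gS (alpha a) (alpha b) C t #|I|%:R rho) => //; last 2 first.
- by apply: uA; rewrite !inE eqxx.
- by apply: uA; rewrite !inE eqxx orbT.
move=> s s0 st; rewrite /g; set u' := (X in msum f X).
have u'a : u' a = (fun v => alpha a - rho v / 2 + s v) by rewrite /u' /setc (negPf ab) eqxx.
have u'b : u' b = (fun v => alpha b - rho v / 2 - s v) by rewrite /u' /setc eqxx.
have u'Q i : Q i -> u' i = u i.
  by move=> /andP[/negPf ia /negPf ib]; rewrite /u' /setc ia ib.
have cases i : [\/ i = a, i = b | Q i].
  rewrite /Q; have [->|_] := eqVneq i a; first by constructor 1.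
  by have [->|_] := eqVneq i b; [constructor 2 | constructor 3].
apply: fC => [i v|v|i].
- have It : 0 <= #|I|%:R * t by rewrite mulr_ge0 ?(ltW M0) ?(ltW t0).
  have := ta i; rewrite mulrDl mul1r => tai.
  case: (cases i) => [E|E|Qi].
  + rewrite E u'a; rewrite E in tai.
    have := rhoM v; have := st v; rewrite !ler_norml => /andP[h1 h2] /andP[h3 h4]; lra.
  + rewrite E u'b; rewrite E in tai.
    have := rhoM v; have := st v; rewrite !ler_norml => /andP[h1 h2] /andP[h3 h4]; lra.
  + rewrite u'Q //; have := (QN _ Qi).1 v; rewrite ler_norml => /andP[h1 h2]; lra.
- have split3 (h : I -> R) : \sum_i h i = h a + h b + \sum_(i | Q i) h i.
    by rewrite (bigD1 a) //= (bigD1 b) ?(eq_sym b) //= addrA.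
  apply: le_trans alpha_sum; rewrite !split3 u'a u'b.
  rewrite (eq_bigr (fun i => u i v)); last by move=> i Qi; rewrite u'Q.
  have : rho v = \sum_(i | Q i) u i v - \sum_(i | Q i) alpha i by rewrite /rho sumrB.
  by lra.
- case: (cases i) => [E|E|Qi].
  + rewrite E u'a big_split /= sumrB sumr_const -mulr_suml rho0 s0 mul0r subr0 addr0.
    by rewrite -[LHS]mulr_natr.
  + rewrite E u'b !sumrB sumr_const -mulr_suml rho0 s0 mul0r !subr0.
    by rewrite -[LHS]mulr_natr.
  + by rewrite u'Q //; exact: (QN _ Qi).2.
Qed.

End FreeInit.

(** * Proof of the theorem *)

Section Extension.
Variables (R : realType) (I : finType) (alpha : I -> R).
Hypotheses (alpha_gt0 : forall i, 0 < alpha i) (alpha_sum : \sum_i alpha i <= 1).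

Definition asize (n : nat) (i : I) : nat := Num.truncn (alpha i * n%:R).

Lemma asize_floor n i : (asize n i)%:Z = Num.floor (alpha i * n%:R).
Proof.
have x0 : 0 <= alpha i * n%:R by rewrite mulr_ge0 // ltW.
apply/esym/floor_def; rewrite -pmulrn truncn_le x0 /=.
by rewrite (_ : (asize n i)%:Z + 1 = (asize n i).+1%:Z) ?truncnS_gt //; lia.
Qed.

Lemma asize_dist n i : `|alpha i * n%:R - (asize n i)%:R| <= 1.
Proof.
have x0 : 0 <= alpha i * n%:R by rewrite mulr_ge0 // ltW.
have h1 : (asize n i)%:R <= alpha i * n%:R by rewrite truncn_le.
have h2 := truncnS_gt (alpha i * n%:R); rewrite -/(asize n i) -natr1 in h2.
by rewrite ler_norml; apply/andP; split; lra.
Qed.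

Lemma asize_sum n : (\sum_i asize n i <= n)%N.
Proof.
rewrite -(ler_nat R) natr_sum; apply: (@le_trans _ _ (\sum_i alpha i * n%:R)).
  by apply: ler_sum => i _; rewrite truncn_le mulr_ge0 // ltW.
by rewrite -mulr_suml ler_piMl.
Qed.

Definition swap_invariant (V : finType) (phi : {ffun I -> V} -> R) :=
  forall (a b : I) (x : {ffun I -> V}), phi [ffun i => x (tperm a b i)] = phi x.

Definition asize_disc (V : finType) (phi : {ffun I -> V} -> R) (c e : R) :=
  forall U : I -> {set V},
  (forall i j, i != j -> [disjoint U i & U j]%B) -> (forall i, #|U i| = asize #|V| i) ->
  `|(\sum_(x : {ffun I -> V}) phi x * \prod_i (x i \in U i)%:R) - c * \prod_i #|U i|%:R|
    <= e * #|V|%:R ^+ #|I|.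

(** The product serves as a positive lower bound common to all entries, in place of a minimum. *)
Lemma alpha_prod i : \prod_j alpha j <= alpha i.
Proof.
have a1 j : alpha j <= 1.
  apply: le_trans alpha_sum; rewrite (bigD1 j) //= lerDl.
  by apply: sumr_ge0 => k _; exact: ltW.
rewrite (bigD1 i) //= ler_piMr ?(ltW (alpha_gt0 i)) //.
by apply: prodr_ile1 => j _; rewrite (ltW (alpha_gt0 j)) a1.
Qed.

Lemma extend_bound (a b : I) : \sum_i alpha i < 1 \/ alpha a != alpha b ->
  exists2 K : R, 0 < K & forall (V : finType) (f : {ffun I -> V} -> R) (C : R),
    (0 < #|V|)%N -> 0 <= C -> (\sum_i alpha i < 1 \/ swap_invariant f) ->
   (forall u : I -> V -> R, (forall i v, 0 <= u i v) ->
      (forall v, \sum_i u i v <= 1) -> (forall i, \sum_v u i v = alpha i * #|V|%:R) ->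
      `|msum f u| <= C) ->
   forall u : I -> V -> R, (forall i v, unit_itv (u i v)) -> `|msum f u| <= K * C.
Proof.
have p0 : 0 < \prod_j alpha j by apply: prodr_gt0.
case: (ltP (\sum_i alpha i) 1) => [lt1 _|ge1 [lt1|ab]].
- pose t := \prod_j alpha j * ((1 - \sum_i alpha i) / #|I|.+1%:R).
  have s0 : 0 <= \sum_i alpha i by apply: sumr_ge0 => i _; exact: ltW.
  have q0 : 0 < (1 - \sum_i alpha i) / #|I|.+1%:R by rewrite divr_gt0 ?ltr0n // subr_gt0.
  have t0 : 0 < t by rewrite mulr_gt0.
  have p1 : \prod_j alpha j <= 1.
    apply: le_trans (alpha_prod a) _; apply: le_trans alpha_sum; rewrite (bigD1 a) //= lerDl.
    by apply: sumr_ge0 => k _; exact: ltW.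
  have ta i : t <= alpha i.
    apply: le_trans (alpha_prod i); rewrite /t ler_piMr ?(ltW p0) //.
    rewrite ler_pdivrMr ?ltr0n // mul1r; apply: (@le_trans _ _ 1); first by rewrite gerBl.
    by rewrite ler1n.
  have It : #|I|%:R * t <= 1 - \sum_i alpha i.
    apply: (@le_trans _ _ (#|I|%:R * ((1 - \sum_i alpha i) / #|I|.+1%:R))).
      by rewrite ler_wpM2l ?ler0n // /t ler_piMl // ltW.
    have q1 : 0 <= 1 - \sum_i alpha i by rewrite subr_ge0.
    by rewrite mulrCA ler_piMr // ler_pdivrMr ?ltr0n // mul1r ler_nat.
  exists ((3 / t) ^+ #|~: (finset.set0 : {set I})|%SET); first by rewrite exprn_gt0 // divr_gt0.
  move=> V f C V0 C0 _ fC u uU.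
  by apply: (free_all V0 t0 ta C0 (free_init_lt fC ta It)) => // i; rewrite inE.
- by [].
- pose t := \prod_j alpha j / #|I|.+1%:R.
  have t0 : 0 < t by rewrite divr_gt0 ?ltr0n.
  have ta i : (#|I|%:R + 1) * t <= alpha i.
    by rewrite natr1 mulrC /t divfK ?alpha_prod // pnatr_eq0.
  have ta' i : t <= alpha i.
    by apply: le_trans (ta i); rewrite ler_peMl ?(ltW t0) // lerDr ler0n.
  have kp0 : 0 < kpolar (alpha a) (alpha b) t #|I|%:R.
    have D0 : 0 < `|alpha b - alpha a| by rewrite normr_gt0 subr_eq0 eq_sym.
    have n0 : 0 <= (#|I|%:R : R) by exact: ler0n.
    rewrite /kpolar; apply: ltr_wpDl; last by rewrite divr_gt0 // exprn_gt0.
    apply: addr_ge0; last by rewrite divr_ge0 // mulr_ge0 // ltW.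
    apply: divr_ge0; last by rewrite mulr_ge0 // ltW.
    by rewrite !addr_ge0 ?exprn_ge0 // divr_ge0 // ltW.
  pose ncoord := #|~: [set a; b]|%SET.
  pose K := (3 / t) ^+ ncoord * kpolar (alpha a) (alpha b) t #|I|%:R.
  exists K; rewrite /K.
    by rewrite mulr_gt0 // exprn_gt0 // divr_gt0.
  move=> V f C V0 C0 [//|fS] fC u uU.
  have kC0 : 0 <= kpolar (alpha a) (alpha b) t #|I|%:R * C by rewrite mulr_ge0 // ltW.
  have fb := free_init_sym V0 alpha_gt0 alpha_sum C0 fC t0 ab (fS a b) ta.
  rewrite -mulrA.
  by apply: (free_all V0 t0 ta' kC0 fb) => // i; rewrite inE.
Qed.

Lemma extend_disc (a b : I) (c : R) : unit_itv c ->
  \sum_i alpha i < 1 \/ alpha a != alpha b ->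
  forall d : R, 0 < d -> exists2 e : R, 0 < e &
  forall (V : finType) (phi : {ffun I -> V} -> R), (0 < #|V|)%N -> #|V|%:R^-1 <= e ->
  (\sum_i alpha i < 1 \/ swap_invariant phi) ->
  (forall x, unit_itv (phi x)) -> asize_disc phi c e ->
  forall u : I -> V -> R, (forall i v, unit_itv (u i v)) ->
  `|\sum_(x : {ffun I -> V}) (phi x - c) * \prod_i u i (x i)| <= d * #|V|%:R ^+ #|I|.
Proof.
move=> cU cond d d0; have [K K0 KP] := extend_bound cond.
set M : R := #|I|%:R ^+ 2.
have M0 : 0 <= M by rewrite exprn_ge0 ?ler0n.
pose q := d / (4 * (K + 1) * (M + 1)).
have den0 : 0 < 4 * (K + 1) * (M + 1).
  have K1 : 0 < K + 1 by rewrite addr_gt0.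
  have M1 : 0 < M + 1 by rewrite ltr_wpDl.
  by rewrite !mulr_gt0.
have q0 : 0 < q by rewrite divr_gt0.
(* [fractional] is used with [l := q]; the condition [n^-1 <= e] then bounds its term (1 / q + 1) /
   n by [q]. *)
pose e := Num.min q (q / (q^-1 + 1)).
have qi0 : 0 < q^-1 + 1 by rewrite addr_gt0 ?invr_gt0.
have e0 : 0 < e by rewrite /e lt_min q0 divr_gt0.
exists e => // V phi V0 ne sw pU disc u uU.
have n0 : 0 < (#|V|%:R : R) by rewrite ltr0n.
set n : R := #|V|%:R in n0 ne *.
(* [fractional] asks for a function vanishing on non-injective tuples. Disjoint sets do not see this
   truncation, and general weights see it only up to M / n. *)
pose f (x : {ffun I -> V}) : R := (injectiveb x)%:R * (phi x - c).
have pc x : `|phi x - c| <= 1.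
  have /andP[h1 h2] := pU x; have /andP[h3 h4] := cU.
  by rewrite ler_norml; apply/andP; split; lra.
have f1 x : `|f x| <= 1 by rewrite /f; case: (injectiveb x); rewrite ?mul1r // mul0r normr0.
have f2 x : ~~ injectiveb (x : {ffun I -> V}) -> f x = 0 by rewrite /f => /negPf ->; rewrite mul0r.
have fd (U : I -> {set V}) : (forall i j, i != j -> [disjoint U i & U j]%B) ->
    (forall i, #|U i| = asize #|V| i) ->
    `|msum f (fun i v => (v \in U i)%:R)| <= e * n ^+ #|I|.
  move=> dU sU; have := disc U dU sU; rewrite -sum_prod_mem mulr_sumr -sumrB.
  congr (`|_| <= _); apply: eq_bigr => x _.
  have [/forallP xU|nU] := boolP [forall i, x i \in U i].
    by rewrite /f (disjoint_inj dU xU) mul1r mulrBl.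
  have -> : \prod_i ((x i \in U i)%:R : R) = 0.
    have E : \prod_i ((x i \in U i)%:R : R) = [forall i, x i \in U i]%:R by exact: prod_bool.
    by rewrite E (negPf nU).
  by rewrite !mulr0 subrr.
have fS : \sum_i alpha i < 1 \/ swap_invariant f.
  case: sw => [lt1|sw]; [by left|right] => a' b' x; rewrite /f sw; congr ((nat_of_bool _)%:R * _).
  apply/injectiveP/injectiveP => xI i j.
    by move=> ij; apply: (@perm_inj _ (tperm a' b')); apply: xI; rewrite !ffunE !tpermK.
  by rewrite !ffunE => /xI/perm_inj.
pose C := (e + M * (q + (q^-1 + 1) / n)) * n ^+ #|I|.
have C0 : 0 <= C.
  rewrite mulr_ge0 ?exprn_ge0 ?(ltW n0) // addr_ge0 ?(ltW e0) // mulr_ge0 // addr_ge0 ?(ltW q0) //.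
  by rewrite divr_ge0 ?(ltW qi0) ?(ltW n0).
have fC (w : I -> V -> R) : (forall i v, 0 <= w i v) ->
      (forall v, \sum_i w i v <= 1) -> (forall i, \sum_v w i v = alpha i * n) ->
      `|msum f w| <= C.
  move=> w0 w1 ws; apply: (@fractional R V I f (asize #|V|) f1 (asize_sum _) f2 e fd w q V0 q0 w0 w1).
  by move=> i; rewrite ws asize_dist.
have h1 := KP V f C V0 C0 fS fC u uU.
have h2 : `|\sum_(x : {ffun I -> V}) (phi x - c) * \prod_i u i (x i) - msum f u|
    <= M / n * n ^+ #|I|.
  rewrite /msum -sumrB; apply: le_trans (ler_norm_sum _ _ _) _.
  apply: (@le_trans _ _ (\sum_(x : {ffun I -> V}) (~~ injectiveb x)%:R)).
    apply: ler_sum => x _; rewrite -mulrBl /f.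
    case: (injectiveb x); first by rewrite mul1r subrr mul0r normr0.
    rewrite mul0r subr0 normrM mulr_ile1 //.
    have /andP[h3 h4] : unit_itv (\prod_i u i (x i)) by apply: unit_itv_prod.
    by rewrite ger0_norm.
  exact: sum_noninj.
set X := \sum_x _ in h2 *.
have -> : X = msum f u + (X - msum f u) by rewrite addrC subrK.
apply: le_trans (ler_normD _ _) _; apply: le_trans (lerD h1 h2) _.
rewrite /C mulrA -mulrDl ler_wpM2r ?exprn_ge0 ?(ltW n0) //.
have eq : e <= q by rewrite /e ge_min lexx.
have nq1 : (q^-1 + 1) / n <= q.
  rewrite mulrC -ler_pdivlMr //; apply: le_trans ne _; by rewrite /e ge_min lexx orbT.
have nq2 : M / n <= M * q by rewrite ler_wpM2l // (le_trans ne).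
have b1 : K * (e + M * (q + (q^-1 + 1) / n)) <= K * (q + M * (q + q)).
  by rewrite ler_wpM2l ?(ltW K0) // lerD // ler_wpM2l // lerD2l.
apply: le_trans (lerD b1 nq2) _.
have -> : d = q * (4 * (K + 1) * (M + 1)) by rewrite /q divfK // gt_eqF.
rewrite -subr_ge0.
have -> : q * (4 * (K + 1) * (M + 1)) - (K * (q + M * (q + q)) + M * q) =
  q * (2 * K * M + 3 * K + 3 * M + 4) by ring.
by rewrite mulr_ge0 ?(ltW q0) // !addr_ge0 // !mulr_ge0 // ltW.
Qed.

End Extension.

Section Backward.
Local Open Scope classical_set_scope.
Local Open Scope ring_scope.
Variables (R : realType) (m : nat) (F : sgraph 'I_m) (p : R) (alpha : 'I_m -> R).
Hypotheses (eF : (0 < num_edges F)%N) (p_gt0 : 0 < p) (p_le1 : p <= 1).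
Hypotheses (alpha_gt0 : forall i, 0 < alpha i) (alpha_sum : \sum_i alpha i <= 1).
Variable G : nat -> graph.
Hypothesis Goo : order_to_infinity G.

Lemma cut_of_disc : (forall d : R, 0 < d -> \forall n \near \oo, hsym_disc F p (gadj R (G n)) d) ->
  cut_random p G.
Proof.
move=> H eta eta0; have [d d0 dP] := cut_of_hsym p_gt0 p_le1 eF eta0.
apply: filterS2 (near_order Goo 1) (H d d0) => n n0 disc.
apply: dP => // [x y|x y]; first exact: gadj_unit.
by rewrite /gadj adj_sym.
Qed.

Lemma edge_density_unit : unit_itv (p ^+ num_edges F).
Proof. by rewrite /unit_itv exprn_ge0 ?(ltW p_gt0) // exprn_ile1 ?(ltW p_gt0). Qed.

(** The count is symmetrised only after the extension to arbitrary weights, which may be permuted.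
    Sets of prescribed sizes may not, as the entries of [alpha] can differ. *)
Lemma cut_of_P : \sum_i alpha i < 1 -> P p F alpha G -> cut_random p G.
Proof.
move=> lt1 HP; apply: cut_of_disc => d d0.
have [ab _] := epair_exists eF.
have [e e0 eP] := @extend_disc R _ alpha alpha_gt0 alpha_sum ab.1 ab.2 _ edge_density_unit (or_introl lt1) d d0.
apply: filterS2 (near_order_invr Goo e0) (HP e e0) => n /andP[n0 ne] HU.
have {}eP := eP _ (fun x => hprod F (gadj R (G n)) x) n0 ne (or_introl lt1) _ _.
have {}eP (u : 'I_m -> vertex (G n) -> R) : (forall i v, unit_itv (u i v)) ->
    `|\sum_(x : {ffun 'I_m -> vertex (G n)})
       (hprod F (gadj R (G n)) x - p ^+ num_edges F) * \prod_i u i (x i)|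
    <= d * #|vertex (G n)|%:R ^+ #|'I_m|.
  apply: eP => [x|U dU sU]; first by apply: hprod_unit => *; exact: gadj_unit.
  rewrite -NU_sum // card_ord; apply: HU; split => // i.
  by rewrite sU asize_floor.
move=> u uU.
have f0 : 0 < ((factorial #|'I_m|)%:R : R) by rewrite ltr0n fact_gt0.
have pE (x : 'I_m -> vertex (G n)) : hsym F (fun _ _ => p) x = p ^+ num_edges F.
  rewrite /hsym (eq_bigr (fun=> p ^+ num_edges F)); last by move=> s _; rewrite hprod_const.
  by rewrite sumr_const card_permT -[X in _ * X]mulr_natl mulKf // gt_eqF.
rewrite (eq_bigr (fun x : {ffun 'I_m -> vertex (G n)} => hsym F (gadj R (G n)) x * \prod_i u i (x i)
   - hsym F (fun _ _ => p) x * \prod_i u i (x i))); last by move=> x _; rewrite pE mulrBl.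
rewrite sumrB !sum_hsym -mulrBr -sumrB -[X in `|X|]subr0; apply: perm_average_le => s.
rewrite subr0 -sumrB; under eq_bigr => y _ do rewrite hprod_const -mulrBl.
exact: (eP (fun i => u (s i))).
Qed.

Lemma hsym_swap (V : finType) (w : V -> V -> R) :
  swap_invariant (fun x : {ffun 'I_m -> V} => hsym F w x).
Proof.
move=> a b x; rewrite /hsym; congr (_ * _).
rewrite (reindex_inj (mulIg (tperm a b))) /=; apply: eq_bigr => s _.
by apply: eq_bigr => e _; rewrite !ffunE !permM !tpermK.
Qed.

Lemma cut_of_Ptilde : \sum_i alpha i < 1 \/ (exists a b, alpha a != alpha b) ->
  Ptilde p F alpha G -> cut_random p G.
Proof.
move=> cond HP; apply: cut_of_disc => d d0.
have [a [b {}cond]] : exists a b, \sum_i alpha i < 1 \/ alpha a != alpha b.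
  case: cond => [lt1|[a [b ab]]]; last by exists a, b; right.
  by have [ab _] := epair_exists eF; exists ab.1, ab.2; left.
have [e e0 eP] := @extend_disc R _ alpha alpha_gt0 alpha_sum a b _ edge_density_unit cond d d0.
apply: filterS2 (near_order_invr Goo e0) (HP e e0) => n /andP[n0 ne] HU u uU.
apply: (eP _ (fun x => hsym F (gadj R (G n)) x) n0 ne (or_intror (@hsym_swap _ _)) _ _ u uU).
  by move=> x; apply: hsym_unit => *; exact: gadj_unit.
move=> U dU sU; rewrite (sum_hsym _ _ (fun i v => (v \in U i)%:R)).
have := HU U; rewrite /NUtilde card_ord.
rewrite (eq_bigr (fun s : 'S_m => \sum_(y : {ffun 'I_m -> vertex (G n)})
    hprod F (gadj R (G n)) y * \prod_i (y i \in U (s i))%:R)); last first.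
  by move=> s _; rewrite NU_sum // => i j ij; apply: dU; rewrite (inj_eq perm_inj).
by apply; split => // i; rewrite sU asize_floor.
Qed.

End Backward.

Section Relabelling.
Local Open Scope classical_set_scope.
Local Open Scope ring_scope.
Variables (R : realType) (W : finType) (F : sgraph W).

Lemma num_edges_relabel (m : nat) (l : 'I_m -> W) : bijective l ->
  num_edges (relabel F l) = num_edges F.
Proof.
move=> [l' lK l'K]; have lI := can_inj lK.
rewrite /num_edges -(card_imset _ (@imset_inj _ _ l lI)); apply: eq_card => s.
apply/imsetP/idP => [[s']|]; rewrite !inE => /existsP[x /existsP[y /andP[xy /eqP ->]]].
  move=> ->; apply/existsP; exists (l x); apply/existsP; exists (l y).
  by rewrite [F _ _]xy /= imsetU1 imset_set1.
exists [set l' x; l' y]%SET; last by rewrite imsetU1 imset_set1 !l'K.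
rewrite inE; apply/existsP; exists (l' x); apply/existsP; exists (l' y).
by rewrite eqxx andbT /= !l'K.
Qed.

Lemma NU_relabel (m : nat) (l : 'I_m -> W) (V : finType) (G : sgraph V)
    (U : 'I_m -> {set V}) (s : 'S_m) :
  (forall i j, i != j -> [disjoint U i & U j]%B) ->
  (NU (relabel F l) G (fun i => U (s i)))%:R =
  (NU (relabel F (fun i => l ((s^-1)%g i))) G U)%:R :> R.
Proof.
move=> dU; rewrite !NU_sum //; last by move=> i j ij; apply: dU; rewrite (inj_eq perm_inj).
rewrite (reindex (fun x : {ffun 'I_m -> V} => [ffun i => x (s i)] : {ffun 'I_m -> V})) /=; last first.
  exists (fun y : {ffun 'I_m -> V} => [ffun i => y ((s^-1)%g i)] : {ffun 'I_m -> V}) => y _;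
    by apply/ffunP => i; rewrite !ffunE ?permK ?permKV.
apply: eq_bigr => x _; congr (_ * _); last first.
  by rewrite [RHS](reindex_inj (@perm_inj _ s)); apply: eq_bigr => i _; rewrite ffunE.
rewrite !hprod_gadj; congr (_%:R); congr nat_of_bool.
apply/forallP/forallP => H i; apply/forallP => j.
  by have /forallP/(_ ((s^-1)%g j)) := H ((s^-1)%g i); rewrite /= !ffunE !permKV.
by have /forallP/(_ (s j)) := H (s i); rewrite /= !permK !ffunE.
Qed.

(** Permuting the sets amounts to relabelling [F] by the inverse permutation, so every term of the
    average is covered by some labelling; these are finitely many, so one threshold serves them
    all. *)
Lemma Ptilde_of_Pu (p : R) (alpha : 'I_#|W| -> R) (G : nat -> graph) (l : 'I_#|W| -> W) :
  bijective l -> Pu p F alpha G -> Ptilde p (relabel F l) alpha G.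
Proof.
move=> lb HPu e e0.
have lsb (s : 'S_#|W|) : bijective (fun i => l ((s^-1)%g i)).
  by apply: (bij_comp lb); exists s; [exact: permKV | exact: permK].
have : \forall n \near \oo, forall s : 'S_#|W|, forall U : 'I_#|W| -> {set vertex (G n)},
   admissible alpha U ->
    `|(NU (relabel F (fun i => l ((s^-1)%g i))) (G n) U)%:R - p ^+ num_edges F * \prod_(i < #|W|) #|U i|%:R|
      <= e * (num_vertices (G n))%:R ^+ #|W|.
  apply: filter_forall => s; have := HPu _ (lsb s) e e0.
  by rewrite (num_edges_relabel (lsb s)).
apply: filterS => n Hn U [dU sU].
rewrite (num_edges_relabel lb) /NUtilde -{1}[#|W|]card_ord; apply: perm_average_le => s.
by rewrite NU_relabel //; exact: Hn.
Qed.

End Relabelling.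

Theorem theorem2p11 (R : realType) (W : finType) (F : sgraph W)
    (p : R) (alpha : 'I_#|W| -> R)
    (eF : (0 < num_edges F)%N) (p_gt0 : 0 < p) (p_le1 : p <= 1)
    (alpha_gt0 : forall i, 0 < alpha i)
    (alpha_sum : \sum_i alpha i <= 1) :
  (~ (forall i, alpha i = #|W|%:R^-1) ->
     (forall l : 'I_#|W| -> W, bijective l ->
        quasi_random_property p (Ptilde p (relabel F l) alpha)) /\
     quasi_random_property p (Pu p F alpha)) /\
  (\sum_i alpha i < 1 ->
     forall l : 'I_#|W| -> W, bijective l ->
       quasi_random_property p (P p (relabel F l) alpha)).
Proof.
have eFl (l : 'I_#|W| -> W) : bijective l -> (0 < num_edges (relabel F l))%N.
  by move=> lb; rewrite num_edges_relabel.
split=> [nalpha|lt1 l lb G Goo]; last first.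
  split=> [HP|qr].
    exact/quasi_random_of_cut/(cut_of_P (eFl l lb) p_gt0 p_le1 alpha_gt0 alpha_sum Goo lt1 HP).
  exact/P_of_cut/cut_of_quasi_random.
have cond : \sum_i alpha i < 1 \/ (exists a b, alpha a != alpha b).
  apply: contrapT => /not_orP[/negP]; rewrite -leNgt => ge1 /forallNP nab.
  have s1 : \sum_i alpha i = 1 by apply/eqP; rewrite eq_le alpha_sum ge1.
  apply: nalpha => i.
  have E j : alpha j = alpha i.
    by apply/eqP; apply: contrapT => /negP ji; apply: (nab j); exists i.
  move: s1; rewrite (eq_bigr (fun=> alpha i)) // sumr_const card_ord -[alpha i *+ _]mulr_natl => s1.
  have W0 : #|W|%:R != 0 :> R.
    by rewrite pnatr_eq0 -lt0n (leq_ltn_trans (leq0n i) (ltn_ord i)).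
  by apply: (mulfI W0); rewrite s1 mulfV.
have tilde l G : bijective l -> order_to_infinity G -> Ptilde p (relabel F l) alpha G -> quasi_random p G.
  move=> lb Goo HP.
  exact/quasi_random_of_cut/(cut_of_Ptilde (eFl l lb) p_gt0 p_le1 alpha_gt0 alpha_sum Goo cond HP).
split=> [l lb G Goo|G Goo]; split=> [HP|qr].
- exact: tilde HP.
- exact/Ptilde_of_cut/cut_of_quasi_random.
- have lb : bijective (@enum_val W W) by exact: enum_val_bij.
  exact: (tilde _ _ lb Goo (Ptilde_of_Pu lb HP)).
- by move=> l lb; exact/P_of_cut/cut_of_quasi_random.
Qed.
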